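(* Let $\varphi$, $\bar x$, $(\bar v,\bar u)=(0,0)$ and $\bar y\in Y(\bar x,\bar u,\bar v)$ be as in the setting described in the context. Suppose the variational sufficient condition for local optimality of $\bar x$ in $\bar{\mathcal P}$ with multiplier $\bar y$ holds. Then $(\bar x,\bar y)$ is (primal-dual) fully stable in $\bar{\mathcal P}$ if and only if $$(0,y')\in D_*[\partial\varphi](\bar x,\bar u\,|\,\bar v,\bar y)(x',0)\ \Longrightarrow\ (x',y')=(0,0).\qquad(\mathrm A)$$ Moreover, criterion (A) can be replaced (in this equivalence) by the coderivative criterion $$(0,y')\in D^*[\partial\varphi](\bar x,\bar u\,|\,\bar v,\bar y)(x',0)\ \Longrightarrow\ (x',y')=(0,0).\qquad(\mathrm B)$$ Under the strong variational sufficient condition for local optimality, (A) can be simplified to $$(0,y')\in D_*[\partial\varphi](\bar x,\bar u\,|\,\bar v,\bar y)(0,0)\ \Longrightarrow\ y'=0,$$ which can in turn be replaced by $$(0,y')\in D^*[\partial\varphi](\bar x,\bar u\,|\,\bar v,\bar y)(0,0)\ \Longrightarrow\ y'=0.$$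
   Context: **Subgradients.** For a lower semicontinuous $f:\mathbb R^N\to(-\infty,\infty]$ and $z$ with $f(z)$ finite: $w$ is a regular subgradient at $z$ if $f(z')\ge f(z)+w\cdot(z'-z)+o(|z'-z|)$; $\partial f(z)$ is the set of (general, limiting) subgradients, i.e. limits of regular subgradients $w_k$ at points $z_k\to z$ with $f(z_k)\to f(z)$; $\partial^\infty f(z)$ (horizon subgradients) is the set of limits of $\lambda_kw_k$ with $\lambda_k\searrow0$ and $w_k$ regular subgradients at $z_k\to z$, $f(z_k)\to f(z)$. **Setting.** $\varphi:\mathbb R^n\times\mathbb R^m\to(-\infty,\infty]$ is a closed (lower semicontinuous) proper function. $\mathcal P(v,u)$ is the problem: minimize $\varphi(x,u)-v\cdot x$ with respect to $x$. $(\bar v,\bar u)=(0,0)$ and $\bar{\mathcal P}=\mathcal P(\bar v,\bar u)$. $\bar x$ is a locally optimal solution to $\bar{\mathcal P}$. $\partial_x\varphi(x,u)$ is the set of subgradients of $\varphi(\cdot,u)$ at $x$. For $(x,u,v)$ with $v\in\partial_x\varphi(x,u)$ put $Y(x,u,v)=\{y: (v,y)\in\partial\varphi(x,u)\}$ (and $Y(x,u,v)=\emptyset$ otherwise). Standing assumptions: (i) basic constraint qualification: $(0,y)\in\partial^\infty\varphi(\bar x,\bar u)\Rightarrow y=0$; (ii) for every $\hat y\in Y(\bar x,\bar u,\bar v)$, $\varphi$ is continuously prox-regular at $(\bar x,\bar u)$ for $(\bar v,\hat y)$, meaning there are neighborhoods $\mathcal X\times\mathcal U$ of $(\bar x,\bar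 u)$ and $\mathcal V\times\mathcal Y$ of $(\bar v,\hat y)$ and $r>0$ such that $\varphi(x',u')\ge\varphi(x,u)+(v,y)\cdot(x'-x,u'-u)-\frac r2|(x'-x,u'-u)|^2$ for all $(x,u),(x',u')\in\mathcal X\times\mathcal U$ and $(v,y)\in\partial\varphi(x,u)\cap[\mathcal V\times\mathcal Y]$, and moreover the function $(x,u,v,y)\in\operatorname{gph}\partial\varphi\mapsto\varphi(x,u)$ is continuous in $\mathcal X\times\mathcal U\times\mathcal V\times\mathcal Y$. A multiplier vector $\bar y\in Y(\bar x,\bar u,\bar v)$ is fixed, so $(\bar v,\bar y)\in\partial\varphi(\bar x,\bar u)$. **Primal-dual full stability.** Let $M_\delta(v,u)=\operatorname{argmin}_{|x-\bar x|\le\delta}\{\varphi(x,u)-v\cdot x\}$, $m_\delta(v,u)=\min_{|x-\bar x|\le\delta}\{\varphi(x,u)-v\cdot x\}$, $\bar M_\delta(v,u)=\{(x,y): x\in M_\delta(v,u),\ y\in Y(x,u,v),\ |y-\bar y|\le\delta\}$. The pair $(\bar x,\bar y)$ is fully stable in $\bar{\mathcal P}$ if for every sufficiently small $\delta>0$ there is a neighborhood $\mathcal V\times\mathcal U$ of $(\bar v,\bar u)=(0,0)$ on which $\bar M_\delta$ is single-valued (exactly one element) and Lipschitz continuous and $m_\delta$ is Lipschitz continuous. **Variational convexity.** A function $f$ on $\mathbb R^n\times\mathbb R^m$ (subdifferentially continuous as in (ii)) is variationally convex at $(\bar x,\bar u)$ for $(\bar v,\bar y)\in\partial f(\bar x,\bar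 u)$ if there are neighborhoods $\mathcal X\times\mathcal U$ of $(\bar x,\bar u)$ and $\mathcal V\times\mathcal Y$ of $(\bar v,\bar y)$ and a closed proper convex function $\psi\le f$ on $\mathcal X\times\mathcal U$ such that, within those neighborhoods, $\operatorname{gph}\partial f$ coincides with $\operatorname{gph}\partial\psi$ and $f(x,u)=\psi(x,u)$ for the elements $(x,u;v,y)$ of the common graph. It is variationally strongly convex if $\psi$ can be taken strongly convex there, i.e. $\psi-\frac s2|\cdot-(\bar x,\bar u)|^2$ convex on $\mathcal X\times\mathcal U$ (convex neighborhood) for some $s>0$. **Variational sufficiency.** The (strong) variational sufficient condition for local optimality of $\bar x$ in $\bar{\mathcal P}$ with multiplier $\bar y$ is the existence of $r>0$ such that $\varphi_r(x,u)=\varphi(x,u)+\frac r2|u|^2$ is variationally (strongly) convex at $(\bar x,\bar u)$ for $(\bar v,\bar y)$. **Generalized derivatives.** For $S:\mathbb R^N\rightrightarrows\mathbb R^M$ and $\bar w\in S(\bar z)$: $w'\in D_*S(\bar z|\bar w)(z')$ (strict graphical derivative) iff there are $t_k\searrow0$, $(z_k,w_k)\to(\bar z,\bar w)$ in $\operatorname{gph}S$ and $(z_k',w_k')\to(z',w')$ with $w_k+t_kw_k'\in S(z_k+t_kz_k')$; $z^*\in D^*S(\bar z|\bar w)(w^* )$ (coderivative) iff $(z^*,-w^* )\in N_{\operatorname{gph}S}(\bar z,\bar w)$, with $N$ the limiting (Mordukhovich) normal cone. *)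

(* Defs.v *)
From HB Require Import structures.
From mathcomp Require Import all_boot all_order all_algebra.
From mathcomp Require Import all_classical all_reals all_analysis.

Set Implicit Arguments.
Unset Strict Implicit.
Unset Printing Implicit Defensive.

Import Order.TTheory GRing.Theory Num.Theory.
Import numFieldNormedType.Exports.

Local Open Scope classical_set_scope.
Local Open Scope ring_scope.

(* R^N is 'rV[R]_N and R^n x R^m is 'rV[R]_(n + m), the pair (x, u) being
   row_mx x u.  The library norm on 'rV[R]_N is the sup norm: it is used only
   for the topology and for Lipschitz continuity, where the choice of norm is
   immaterial.  Wherever the norm itself matters the Euclidean norm enorm is
   used. *)

Section Euclidean.
Variables (R : realType) (N : nat).

Definition dot (a b : 'rV[R]_N) : R := \sum_(i < N) a 0 i * b 0 i.

Definition enorm (a : 'rV[R]_N) : R := Num.sqrt (dot a a).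

End Euclidean.

Definition box (R : realType) (N M : nat) (A : set 'rV[R]_N)
    (B : set 'rV[R]_M) : set 'rV[R]_(N + M) :=
  [set p | A (lsubmx p) /\ B (rsubmx p)].

Section Subgradients.
Variables (R : realType) (N : nat).
Implicit Types (f : 'rV[R]_N -> \bar R) (z w : 'rV[R]_N).

Definition proper_function f :=
  (forall z, f z != -oo%E) /\ (exists z, f z != +oo%E).

Definition regular_subgradient f z : set 'rV[R]_N := [set w |
  f z \is a fin_num /\
  forall e : R, 0 < e -> \forall z' \near z,
    (f z + (dot w (z' - z) - e * enorm (z' - z))%:E <= f z')%E].

Definition subgradient f z : set 'rV[R]_N := [set w |
  f z \is a fin_num /\
  exists z_ w_ : nat -> 'rV[R]_N,
    [/\ z_ @ \oo --> z, f (z_ k) @[k --> \oo] --> f z, w_ @ \oo --> w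
      & forall k, regular_subgradient f (z_ k) (w_ k)]].

(* l_ \searrow 0 means positive and tending to 0: passing to a subsequence
   makes it monotone without changing the limit set *)
Definition horizon_subgradient f z : set 'rV[R]_N := [set w |
  f z \is a fin_num /\
  exists (z_ w_ : nat -> 'rV[R]_N) (l_ : nat -> R),
    [/\ z_ @ \oo --> z, f (z_ k) @[k --> \oo] --> f z,
        (forall k, 0 < l_ k) /\ l_ @ \oo --> (0 : R),
        l_ k *: w_ k @[k --> \oo] --> w
      & forall k, regular_subgradient f (z_ k) (w_ k)]].

Definition convex_on (C : set 'rV[R]_N) f :=
  forall z z' (t : R), C z -> C z' -> 0 <= t <= 1 ->
    (f (t *: z + (1 - t) *: z')%R <= t%:E * f z + (1 - t)%:E * f z')%E.

End Subgradients.

Section GeneralizedDerivatives.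
Variables (R : realType) (N M : nat).
Implicit Types (S : 'rV[R]_N -> set 'rV[R]_M) (z : 'rV[R]_N) (w : 'rV[R]_M).

Definition gph S : set 'rV[R]_(N + M) := [set p | S (lsubmx p) (rsubmx p)].

Definition strict_graphical_derivative S z w (z' : 'rV[R]_N)
    : set 'rV[R]_M := [set w' |
  exists (t_ : nat -> R) (z_ dz_ : nat -> 'rV[R]_N) (w_ dw_ : nat -> 'rV[R]_M),
    [/\ (forall k, 0 < t_ k) /\ t_ @ \oo --> (0 : R),
        z_ @ \oo --> z /\ w_ @ \oo --> w,
        dz_ @ \oo --> z' /\ dw_ @ \oo --> w',
        forall k, S (z_ k) (w_ k)
      & forall k, S (z_ k + t_ k *: dz_ k) (w_ k + t_ k *: dw_ k)]].

Definition regular_normal_cone K (C : set 'rV[R]_K) (p : 'rV[R]_K)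
    : set 'rV[R]_K := [set q |
  C p /\
  forall e : R, 0 < e -> \forall p' \near p,
    C p' -> dot q (p' - p) <= e * enorm (p' - p)].

Definition limiting_normal_cone K (C : set 'rV[R]_K) (p : 'rV[R]_K)
    : set 'rV[R]_K := [set q |
  C p /\
  exists p_ q_ : nat -> 'rV[R]_K,
    [/\ p_ @ \oo --> p, q_ @ \oo --> q
      & forall k, regular_normal_cone C (p_ k) (q_ k)]].

Definition coderivative S z w (w' : 'rV[R]_M) : set 'rV[R]_N := [set z' |
  limiting_normal_cone (gph S) (row_mx z w) (row_mx z' (- w'))].

End GeneralizedDerivatives.

Section VariationalConvexity.
Variables (R : realType) (n m : nat).
Implicit Types (f psi : 'rV[R]_(n + m) -> \bar R).
Implicit Types (x v : 'rV[R]_n) (u y : 'rV[R]_m).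

Definition continuously_prox_regular f x u v y :=
  exists X U V Y, exists r : R,
    [/\ [/\ nbhs x X, nbhs u U, nbhs v V & nbhs y Y], 0 < r,
        forall z z' w, box X U z -> box X U z' ->
          subgradient f z w -> box V Y w ->
          (f z + (dot w (z' - z) - r / 2 * enorm (z' - z) ^+ 2)%:E <= f z')%E
      & {within gph (subgradient f) `&` box (box X U) (box V Y),
           continuous (fun p => f (lsubmx p))}].

Definition convex_model f psi (X : set 'rV[R]_n) (U : set 'rV[R]_m)
    (V : set 'rV[R]_n) (Y : set 'rV[R]_m) :=
  [/\ [/\ lower_semicontinuous psi, proper_function psi & convex_on setT psi],
      forall z, box X U z -> (psi z <= f z)%E,
      gph (subgradient f) `&` box (box X U) (box V Y) =
      gph (subgradient psi) `&` box (box X U) (box V Y)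
    & forall p, (gph (subgradient f) `&` box (box X U) (box V Y)) p ->
        f (lsubmx p) = psi (lsubmx p)].

Definition variationally_convex f x u v y :=
  subgradient f (row_mx x u) (row_mx v y) /\
  exists X U V Y psi,
    [/\ nbhs x X, nbhs u U, nbhs v V, nbhs y Y & convex_model f psi X U V Y].

Definition variationally_strongly_convex f x u v y :=
  subgradient f (row_mx x u) (row_mx v y) /\
  exists X U V Y psi,
    [/\ [/\ nbhs x X, nbhs u U, nbhs v V & nbhs y Y],
        convex_model f psi X U V Y, convex_set (box X U)
      & exists2 s : R, 0 < s & convex_on (box X U)
          (fun z => psi z - (s / 2 * enorm (z - row_mx x u) ^+ 2)%:E)%E].

End VariationalConvexity.

Section ParametricProblem.
Variables (R : realType) (n m : nat) (phi : 'rV[R]_(n + m) -> \bar R).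
Implicit Types (x v : 'rV[R]_n) (u y : 'rV[R]_m).

Definition objective v u x : \bar R := (phi (row_mx x u) - (dot v x)%:E)%E.

Definition locally_optimal v u x :=
  objective v u x \is a fin_num /\
  \forall x' \near x, (objective v u x <= objective v u x')%E.

Definition partial_subgradient x u : set 'rV[R]_n :=
  subgradient (fun x' => phi (row_mx x' u)) x.

Definition multipliers x u v : set 'rV[R]_m := [set y |
  partial_subgradient x u v /\ subgradient phi (row_mx x u) (row_mx v y)].

Definition basic_cq x u :=
  forall y, horizon_subgradient phi (row_mx x u) (row_mx 0 y) -> y = 0.

(* a minimum as soon as M_delta below is nonempty *)
Definition m_delta (xb : 'rV[R]_n) (delta : R) v u : \bar R :=
  ereal_inf [set objective v u x | x in [set x | enorm (x - xb) <= delta]].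

(* the argmin of a function that is identically +oo is empty *)
Definition M_delta (xb : 'rV[R]_n) (delta : R) v u : set 'rV[R]_n := [set x |
  [/\ enorm (x - xb) <= delta, (objective v u x < +oo)%E
    & objective v u x = m_delta xb delta v u]].

Definition Mbar_delta (xb : 'rV[R]_n) (yb : 'rV[R]_m) (delta : R) v u
    : set 'rV[R]_(n + m) := [set p |
  [/\ M_delta xb delta v u (lsubmx p),
      multipliers (lsubmx p) u v (rsubmx p)
    & enorm (rsubmx p - yb) <= delta]].

Definition fully_stable (vb : 'rV[R]_n) (ub : 'rV[R]_m) (xb : 'rV[R]_n)
    (yb : 'rV[R]_m) :=
  \forall delta \near (0 : R)^'+, exists V U,
    [/\ nbhs vb V, nbhs ub U,
        exists2 s : 'rV[R]_(n + m) -> 'rV[R]_(n + m),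
          forall v u, V v -> U u ->
            Mbar_delta xb yb delta v u = [set s (row_mx v u)]
          & [lipschitz s p | p in box V U]
      & exists2 mu : 'rV[R]_(n + m) -> R^o,
          forall v u, V v -> U u ->
            m_delta xb delta v u = (mu (row_mx v u))%:E
          & [lipschitz mu p | p in box V U]].

Definition augmented (r : R) (z : 'rV[R]_(n + m)) : \bar R :=
  (phi z + (r / 2 * enorm (rsubmx z) ^+ 2)%:E)%E.

Definition variational_sufficiency x u v y :=
  exists2 r : R, 0 < r & variationally_convex (augmented r) x u v y.

Definition strong_variational_sufficiency x u v y :=
  exists2 r : R, 0 < r & variationally_strongly_convex (augmented r) x u v y.

End ParametricProblem.

(* Main.v *)
(* Set [q = (v, u)] and [g = (x, y)].  The partial inverse of a subgradient map,
   the relation [(v, y) \in d f (x, u)] read as [q -> g], is monotone whenever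
   [d f] is, and so is maximal: [q + g] is the same vector as [(x, u) + (v, y)],
   so Minty's theorem for [d psi] provides a firmly nonexpansive resolvent
   [J : q + g |-> q] for the partial inverse [G] of [d psi].  Near the reference
   point, [d phi] is [d psi] up to the shear [y |-> y + r u], which affects
   neither criterion.
   - Coderivative criterion => full stability.  If every limiting normal [(a, 0)]
     to the graph of [G] has [a = 0], minimizing [|J p - q| + c |p - p0|^2] shows
     that [J] is metrically regular near the reference point; monotonicity then
     makes [J] injective there, so [G] is locally single-valued, everywhere
     defined and Lipschitz.  The subgradient inequality of [psi] identifies its
     values with the minimizers of the tilted problem.
   - Full stability => strict derivative criterion.  Points of the graph near the
     reference point are values of the Lipschitz map [Mbar_delta].
   - Strict derivative criterion => coderivative criterion.  If [(a', b)] is a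
     regular normal with [b] small, then moving [p] by [t (a' - b)] moves [q] by
     [o(t)], by firm nonexpansiveness; so limiting normals [(a, 0)] are strict
     tangents [(0, a)].
   - In the strong case, strong monotonicity of [d psi] forces the [x]-component
     of every such tangent to vanish. *)
Require Import Defs.
From HB Require Import structures.
From mathcomp Require Import all_boot all_order all_algebra.
From mathcomp Require Import all_classical all_reals all_analysis.
From mathcomp Require Import ring lra.

Set Implicit Arguments.
Unset Strict Implicit.
Unset Printing Implicit Defensive.

Import Order.TTheory GRing.Theory Num.Theory.
Import numFieldNormedType.Exports.

Local Open Scope classical_set_scope.
Local Open Scope ring_scope.

(** * Euclidean norm *)

Section EuclideanNorm.
Variables (R : realType) (N : nat).
Implicit Types a b c z : 'rV[R]_N.

Lemma dotC a b : dot a b = dot b a.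
Proof. by apply: eq_bigr => i _; rewrite mulrC. Qed.

Lemma dotDl a b c : dot (a + b) c = dot a c + dot b c.
Proof. by rewrite /dot -big_split; apply: eq_bigr => i _; rewrite mxE mulrDl. Qed.

Lemma dotZl (k : R) a c : dot (k *: a) c = k * dot a c.
Proof. by rewrite /dot mulr_sumr; apply: eq_bigr => i _; rewrite mxE mulrA. Qed.

Lemma dotNl a c : dot (- a) c = - dot a c.
Proof. by rewrite -scaleN1r dotZl mulN1r. Qed.

Lemma dotDr a b c : dot c (a + b) = dot c a + dot c b.
Proof. by rewrite dotC dotDl !(dotC c). Qed.

Lemma dotZr (k : R) a c : dot c (k *: a) = k * dot c a.
Proof. by rewrite dotC dotZl (dotC c). Qed.

Lemma dotNr a c : dot c (- a) = - dot c a.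
Proof. by rewrite dotC dotNl (dotC c). Qed.

Lemma dot0l c : dot 0 c = 0.
Proof. by rewrite -(scale0r 0) dotZl mul0r. Qed.

Lemma dot0r c : dot c 0 = 0.
Proof. by rewrite dotC dot0l. Qed.

Definition dotE := (dotDl, dotDr, dotNl, dotNr, dotZl, dotZr).

Lemma dot_ge0 a : 0 <= dot a a.
Proof. by apply: sumr_ge0 => i _; rewrite -expr2 sqr_ge0. Qed.

Lemma enorm_ge0 a : 0 <= enorm a.
Proof. exact: sqrtr_ge0. Qed.

Lemma sqr_enorm a : enorm a ^+ 2 = dot a a.
Proof. by rewrite sqr_sqrtr // dot_ge0. Qed.

Lemma enorm0 : enorm (0 : 'rV[R]_N) = 0.
Proof. by rewrite /enorm dot0l sqrtr0. Qed.

Lemma enormZ (k : R) a : enorm (k *: a) = `|k| * enorm a.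
Proof.
by rewrite /enorm dotZl dotZr mulrA -expr2 sqrtrM ?sqr_ge0 // sqrtr_sqr.
Qed.

Lemma enormZ_ge0 (k : R) a : 0 <= k -> enorm (k *: a) = k * enorm a.
Proof. by move=> k0; rewrite enormZ ger0_norm. Qed.

Lemma enormN a : enorm (- a) = enorm a.
Proof. by rewrite -scaleN1r enormZ normrN1 mul1r. Qed.

Lemma enormB a b : enorm (a - b) = enorm (b - a).
Proof. by rewrite -opprB enormN. Qed.

Lemma enorm_eq0 a : enorm a = 0 -> a = 0.
Proof.
move=> a0; have : dot a a = 0 by rewrite -sqr_enorm a0 expr0n.
move/eqP; rewrite psumr_eq0 => [/allP h|i _]; last by rewrite -expr2 sqr_ge0.
apply/rowP => i; rewrite mxE; apply/eqP.
by have := h i (mem_index_enum _); rewrite -expr2 sqrf_eq0.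
Qed.

Lemma enorm_gt0 a : a != 0 -> 0 < enorm a.
Proof.
move=> a0; rewrite lt_neqAle enorm_ge0 andbT eq_sym.
by apply: contra_neq a0 => /enorm_eq0.
Qed.

(** Cauchy-Schwarz: for nonzero [a] and [b], expand the squared norm of
    [enorm b *: a - enorm a *: b]. *)
Lemma dot_le a b : dot a b <= enorm a * enorm b.
Proof.
have [->|b0] := eqVneq b 0; first by rewrite dot0r enorm0 mulr0.
have [->|a0] := eqVneq a 0; first by rewrite dot0l enorm0 mul0r.
have := dot_ge0 (enorm b *: a - enorm a *: b).
rewrite !dotE (dotC b a) -!sqr_enorm.
have := enorm_gt0 a0; have := enorm_gt0 b0.
move: (enorm a) (enorm b) (dot a b) => s t d t0 s0 h.
have : 0 <= (s * t) * (s * t - d) by nra.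
by rewrite pmulr_rge0 ?mulr_gt0 // subr_ge0.
Qed.

Lemma enormD a b : enorm (a + b) <= enorm a + enorm b.
Proof.
rewrite -(@ler_pXn2r _ 2) ?nnegrE ?addr_ge0 ?enorm_ge0 //.
rewrite sqrrD !sqr_enorm !dotE (dotC b a).
have := dot_le a b; lra.
Qed.

Lemma enorm_subD c a b : enorm (a - b) <= enorm (a - c) + enorm (c - b).
Proof. by rewrite -(subrKA c a (- b)) enormD. Qed.

Lemma dot_ge a b : - (enorm a * enorm b) <= dot a b.
Proof. by have := dot_le (- a) b; rewrite dotNl enormN; lra. Qed.

Lemma normr_coord a i : `|a 0 i| <= `|a|.
Proof.
rewrite [leRHS]/Num.norm /= mx_normrE; apply/bigmax_geP; right => /=.
by exists (0, i).
Qed.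

Lemma normr_le_enorm a : `|a| <= enorm a.
Proof.
rewrite [leLHS]/Num.norm /= mx_normrE; apply/bigmax_leP; split.
  exact: enorm_ge0.
move=> [i j] _ /=; rewrite ord1.
rewrite -(@ler_pXn2r _ 2) ?nnegrE ?enorm_ge0 // sqr_enorm real_normK ?num_real//.
rewrite /dot (bigD1 j) //= -expr2 lerDl.
by apply: sumr_ge0 => k _; rewrite -expr2 sqr_ge0.
Qed.

(** The crude factor [N.+1] stays positive for [N = 0], so one may divide by it. *)
Lemma enorm_le_normr a : enorm a <= N.+1%:R * `|a|.
Proof.
rewrite -(@ler_pXn2r _ 2) ?nnegrE ?enorm_ge0 ?mulr_ge0 // sqr_enorm.
apply: (@le_trans _ _ (\sum_(i < N) `|a| ^+ 2)).
  apply: ler_sum => i _; rewrite -expr2 -(@real_normK _ (a 0 i)) ?num_real //.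
  by rewrite ler_pXn2r ?nnegrE // normr_coord.
rewrite sumr_const card_ord -[leLHS]mulr_natl exprMn ler_wpM2r ?sqr_ge0 //.
by rewrite -natrX ler_nat expnS expn1 mulSn (leq_trans (leqnSn N)) // leq_addr.
Qed.

(** The ambient topology comes from the sup norm; this equivalence lets the later estimates be made
    in the Euclidean norm. *)
Lemma nbhs_enormP z (A : set 'rV[R]_N) :
  nbhs z A <-> exists2 d, 0 < d & forall z', enorm (z' - z) < d -> A z'.
Proof.
split=> [/nbhs_ballP[d /= d0 h]|[d d0 h]].
  exists d => // z' zz'; apply: h; rewrite -ball_normE /= distrC.
  exact: le_lt_trans (normr_le_enorm _) zz'.
apply/nbhs_ballP; exists (d / N.+1%:R) => /=; first by rewrite divr_gt0.
move=> z'; rewrite -ball_normE /= distrC => zz'; apply: h.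
apply: le_lt_trans (enorm_le_normr _) _.
by rewrite mulrC -ltr_pdivlMr.
Qed.

Lemma cvg_enormP (z_ : nat -> 'rV[R]_N) z : z_ @ \oo --> z <->
  forall e, 0 < e -> exists K, forall k, (K <= k)%N -> enorm (z_ k - z) < e.
Proof.
split=> [h e e0|h].
  have : nbhs z [set z' | enorm (z' - z) < e] by apply/nbhs_enormP; exists e.
  by move=> /h[K _ hK]; exists K => k /hK.
move=> A /nbhs_enormP[d d0 hA]; have [K hK] := h d d0.
by exists K => // k /= /hK; exact: hA.
Qed.

Lemma lipschitz_enorm_continuous (f : 'rV[R]_N -> R) (C : R) :
  (forall z z', `|f z - f z'| <= C * enorm (z - z')) -> continuous f.
Proof.
move=> fC z A /nbhs_ballP[e /= e0 hA]; apply/nbhs_enormP.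
have C1 : 0 < `|C| + 1 by rewrite ltr_wpDl.
exists (e / (`|C| + 1)) => [|z' hz]; first by rewrite divr_gt0.
apply: hA; rewrite -ball_normE /= distrC; apply: le_lt_trans (fC _ _) _.
move: hz; rewrite ltr_pdivlMr // => hz; apply: le_lt_trans hz.
rewrite mulrC ler_wpM2l ?enorm_ge0 //.
by apply: le_trans (ler_norm _) _; rewrite lerDl.
Qed.

Lemma enorm_sub_le a b : `|enorm a - enorm b| <= enorm (a - b).
Proof.
rewrite ler_norml; have := enormD (a - b) b; have := enormD (b - a) a.
by rewrite !subrK (enormB b a) => h1 h2; lra.
Qed.

Lemma enorm_continuous (c : 'rV[R]_N) : continuous (fun z => enorm (z - c)).
Proof.
apply: (@lipschitz_enorm_continuous _ 1) => z z'.
apply: le_trans (enorm_sub_le _ _) _.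
by rewrite mul1r opprB addrA subrK.
Qed.

Lemma compact_eball z (d : R) : compact [set z' : 'rV[R]_N | enorm (z' - z) <= d].
Proof.
apply: bounded_closed_compact.
  exists (d + `|z|); split; first exact: num_real.
  move=> M dM z' /= hz'; apply: le_trans (ltW dM).
  rewrite -(subrK z z'); apply: le_trans (ler_normD _ _) _.
  by rewrite lerD2r; apply: le_trans (normr_le_enorm _) _.
have -> : [set z' : 'rV[R]_N | enorm (z' - z) <= d] =
  (fun z' => enorm (z' - z)) @^-1` [set t | t <= d] by [].
by apply: preimage_closed (@closed_le _ d); move=> z' _; exact: enorm_continuous.
Qed.

End EuclideanNorm.

(** * Monotone relations and their resolvents *)

Section Relations.
Variables (R : realType) (N : nat).
Implicit Types (G H : 'rV[R]_N -> 'rV[R]_N -> Prop) (q g p a b : 'rV[R]_N).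
Implicit Types A : 'M[R]_N.

Definition monotone G := forall q g q' g',
  G q g -> G q' g' -> 0 <= dot (g' - g) (q' - q).

(** Surjectivity of [I + G]; for monotone [G] this is Minty's characterization of maximality. *)
Definition resolvent_onto G := forall p, exists q, G q (p - q).

(** Regular normals to the graph of [H], measured with the sum of the two norms rather than the norm
    of the pair. *)
Definition normal_pair H q g a b := H q g /\
  forall e : R, 0 < e -> exists2 d, 0 < d & forall q' g', H q' g' ->
    enorm (q' - q) < d -> enorm (g' - g) < d ->
    dot a (q' - q) + dot b (g' - g) <= e * (enorm (q' - q) + enorm (g' - g)).

(* Sequence-free form of: [a] is in the strict graphical derivative of [H] at
   [(qb, gb)] in the direction 0. *)
Definition tangent_kernel H qb gb a := forall e : R, 0 < e ->
  exists (t : R) q g dq dg,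
  [/\ 0 < t < e, enorm (q - qb) < e /\ enorm (g - gb) < e,
      enorm dq < e /\ enorm (dg - a) < e, H q g
    & H (q + t *: dq) (g + t *: dg)].

(* Sequence-free form of: [(a, 0)] is a limiting normal to the graph of [H] at
   [(qb, gb)]. *)
Definition normal_kernel H qb gb a := forall e : R, 0 < e ->
  exists q g a' b,
  [/\ enorm (q - qb) < e /\ enorm (g - gb) < e,
      enorm (a' - a) < e /\ enorm b < e & normal_pair H q g a' b].

(** Local uniqueness is the second clause with [q1 = q2]; for [q] close to [qb], the growth bound of
    the first clause puts [g] where the second applies. *)
Definition lipschitz_localization H qb gb := exists2 rho : R, 0 < rho &
  exists2 L : R, 0 < L &
  (forall q, enorm (q - qb) < rho ->
     exists2 g, H q g & enorm (g - gb) <= L * enorm (q - qb)) /\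
  (forall q1 g1 q2 g2, H q1 g1 -> H q2 g2 ->
     enorm (q1 - qb) < rho -> enorm (g1 - gb) < rho ->
     enorm (q2 - qb) < rho -> enorm (g2 - gb) < rho ->
     enorm (g1 - g2) <= L * enorm (q1 - q2)).

(** Dividing the Lipschitz estimate by [t] gives [|dg| <= L |dq|], where [dq] tends to 0 and [dg] to
    [a]. *)
Lemma tangent_kernel_lipschitz H qb gb a (rho L : R) : 0 < rho -> 0 < L ->
  (forall q1 g1 q2 g2, H q1 g1 -> H q2 g2 ->
     enorm (q1 - qb) < rho -> enorm (g1 - gb) < rho ->
     enorm (q2 - qb) < rho -> enorm (g2 - gb) < rho ->
     enorm (g1 - g2) <= L * enorm (q1 - q2)) ->
  tangent_kernel H qb gb a -> a = 0.
Proof.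
move=> rho0 L0 Hlip Ha; apply: contrapT => /eqP /enorm_gt0 a0.
(* The bound involving [rho] keeps both graph points in the ball; the last one makes
   [enorm dg <= L * enorm dq] impossible. *)
pose e : R := Num.min (Num.min 1 (rho / (2 + enorm a)))
              (enorm a / (2 * (L + 1))).
have e0 : 0 < e by rewrite !lt_min ltr01 !divr_gt0 //; nra.
have e1 : e <= 1 by rewrite !ge_min lexx.
have e2 : e * (2 + enorm a) <= rho.
  by rewrite -ler_pdivlMr ?ge_min ?lexx ?orbT //; nra.
have e3 : e * (2 * (L + 1)) <= enorm a.
  by rewrite -ler_pdivlMr ?ge_min ?lexx ?orbT //; nra.
clearbody e.
have [t [q [g [dq [dg [/andP[t0 te] [hq hg] [hdq hdg] h1 h2]]]]]] := Ha _ (divr_gt0 e0 (ltr0n R 2)).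
have dgn : enorm dg <= e / 2 + enorm a.
  by rewrite -(subrK a dg); apply: le_trans (enormD _ _) _; lra.
have /= := Hlip _ _ _ _ h2 h1.
have nn : forall x y z : 'rV[R]_N, x + t *: z - y = (x - y) + t *: z.
  by move=> x y z; rewrite addrAC.
rewrite !nn !subrr !add0r !enormZ_ge0 ?(ltW t0) //.
have := enormD (q - qb) (t *: dq); have := enormD (g - gb) (t *: dg).
rewrite !enormZ_ge0 ?(ltW t0) // => k1 k2.
have := enorm_ge0 dq; have := enorm_ge0 dg => n1 n2.
move=> /(_ _ _ _ _)/wrap[].
- by nra.
- by nra.
- by nra.
- by nra.
rewrite mulrCA ler_pM2l // => k3.
have := enormD (a - dg) dg; rewrite subrK enormB; nra.
Qed.

(** * The resolvent of a maximal monotone relation *)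

Section MonotoneResolvent.
Variable G : 'rV[R]_N -> 'rV[R]_N -> Prop.
Hypotheses (monG : monotone G) (ontoG : resolvent_onto G).

Lemma resolvent_exists : {J : 'rV[R]_N -> 'rV[R]_N | forall p, G (J p) (p - J p)}.
Proof.
apply: constructive_indefinite_description.
by have /choice[J hJ] := ontoG; exists J.
Qed.

Definition resolvent := sval resolvent_exists.
Local Notation J := resolvent.

Lemma resolventP p : G (J p) (p - J p).
Proof. exact: (svalP resolvent_exists). Qed.

(** This is monotonicity of [G] at the graph points [(J p, p - J p)] and [(J p', p' - J p')]. *)
Lemma resolvent_firm p p' :
  dot (J p' - J p) (J p' - J p) <= dot (J p' - J p) (p' - p).
Proof.
have := monG (resolventP p) (resolventP p').
have -> : p' - J p' - (p - J p) = (p' - p) - (J p' - J p).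
  by apply/rowP => i; rewrite !mxE; ring.
by rewrite (dotC (_ - _ - _)) !dotE; lra.
Qed.

Lemma resolvent_nonexpansive p p' : enorm (J p' - J p) <= enorm (p' - p).
Proof.
have := resolvent_firm p p'; rewrite -sqr_enorm => h.
have := le_trans h (dot_le _ _); have := enorm_ge0 (J p' - J p).
have := enorm_ge0 (p' - p); nra.
Qed.

(** With [x] and [y] the increments of [J] and of [p], firmness gives
    [|y - x|^2 <= |y|^2 - |x|^2]. *)
Lemma co_resolvent_nonexpansive p p' :
  enorm ((p' - J p') - (p - J p)) <= enorm (p' - p).
Proof.
have -> : p' - J p' - (p - J p) = (p' - p) - (J p' - J p).
  by apply/rowP => i; rewrite !mxE; ring.
rewrite -(@ler_pXn2r _ 2) ?nnegrE ?enorm_ge0 // !sqr_enorm.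
have := resolvent_firm p p'; have := dot_ge0 (J p' - J p).
move: (J p' - J p) (p' - p) => x y; rewrite !dotE (dotC y x); lra.
Qed.

Lemma resolvent_graph q g : G q g -> J (q + g) = q.
Proof.
move=> Gqg; apply/subr0_eq/enorm_eq0.
have := monG Gqg (resolventP (q + g)).
have -> : q + g - J (q + g) - g = - (J (q + g) - q).
  by apply/rowP => i; rewrite !mxE; ring.
rewrite dotNl -sqr_enorm => h; apply/eqP.
by rewrite -sqrf_eq0 eq_le sqr_ge0 andbT; lra.
Qed.

(* Moving the base point by [t (a - b)] in the resolvent coordinate [q + g],
   firm nonexpansiveness gives [|dq|^2 <= t (a - b) . dq = o(t^2)]. *)
Lemma normal_kernel_tangent qb gb a :
  normal_kernel G qb gb a -> tangent_kernel G qb gb a.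
Proof.
move=> ha e e0.
pose M := enorm a + 2.
have M2 : 2 <= M by rewrite lerDr enorm_ge0.
(* Here 48 is 3 times 16: [h5] bounds [dot c x] by [3 * t * M * e1], and [dq_small] asks that
   [3 * M * e1] be at most [(e / 4) ^+ 2]. *)
pose e1 := Num.min (Num.min 1 (e / 4)) (e ^+ 2 / (48 * M)).
have e10 : 0 < e1 by rewrite !lt_min ltr01 !divr_gt0 ?exprn_gt0 //=; lra.
have e11 : e1 <= 1 by rewrite !ge_min lexx.
have e12 : e1 <= e / 4 by rewrite !ge_min lexx orbT.
have e13 : e1 * (48 * M) <= e ^+ 2.
  by rewrite -ler_pdivlMr ?ge_min ?lexx ?orbT //; lra.
clearbody e1.
have [q [g [a' [b [[hq hg] [haa hb] [Gqg nab]]]]]] := ha e1 e10.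
have [d d0 hd] := nab e1 e10.
pose c := a' - b.
have cM : enorm c <= M.
  have := enorm_subD 0 a' b; rewrite subr0 sub0r enormN.
  have := enormD (a' - a) a; rewrite subrK /M -/c; lra.
(* Both components move by at most [t * M], hence by less than [d], and the normal inequality
   applies. *)
pose t := Num.min (e / 2) (d / (2 * M)).
have t0 : 0 < t by rewrite lt_min !divr_gt0 //; lra.
have t1 : t <= e / 2 by rewrite ge_min lexx.
have t2 : t * (2 * M) <= d.
  by rewrite -ler_pdivlMr ?ge_min ?lexx ?orbT //; lra.
clearbody t; have t0' := ltW t0.
have hJ := resolvent_graph Gqg.
set p := q + g in hJ.
have c_ge0 := enorm_ge0 c.
have := resolvent_nonexpansive p (p + t *: c).
have := co_resolvent_nonexpansive p (p + t *: c).
have := resolvent_firm p (p + t *: c).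
have := resolventP (p + t *: c); rewrite hJ.
set q' := J _; set g' := p + t *: c - q' => Gq'.
have -> : p + t *: c - p = t *: c by rewrite addrC addKr.
have -> : p - q = g by rewrite /p addrC addKr.
rewrite enormZ_ge0 // dotZr => h1 h2 h3.
have := hd _ _ Gq' _ _; move=> /(_ _ _)/wrap[]; [nra|nra|] => h4.
set x := q' - q in h1 h2 h3 h4.
have eg : g' - g = t *: c - x.
  by rewrite /x /g' /p; apply/rowP => i; rewrite !mxE; ring.
(* Since [g' - g = t *: c - x], the normal inequality bounds [dot c x + t * dot b c], and [b] is
   small. *)
have h5 : dot c x <= t * M * (3 * e1).
  have -> : c = a' - b by [].
  move: h4; rewrite eg (dotDr (t *: c)) dotNr dotZr => h4.
  have := dot_ge b c => h6; rewrite dotDl dotNl.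
  have h7 : enorm b * enorm c <= e1 * M.
    by apply: ler_pM; rewrite ?enorm_ge0 // ltW.
  have h8 : e1 * (enorm x + enorm (g' - g)) <= e1 * (2 * (t * M)).
    by rewrite ler_pM2l //; nra.
  move: h8; rewrite eg; nra.
pose dq := t^-1 *: x.
have tdq : t *: dq = x by rewrite scalerA mulfV ?scale1r // gt_eqF.
have dq_small : enorm dq <= e / 4.
  rewrite enormZ_ge0 ?invr_ge0 // mulrC ler_pdivrMr //.
  rewrite -(@ler_pXn2r _ 2) ?nnegrE ?enorm_ge0 ?mulr_ge0 ?divr_ge0 ?(ltW e0) //.
  rewrite sqr_enorm; apply: le_trans h1 _; rewrite dotC.
  have : t * dot c x <= t * (t * M * (3 * e1)) by rewrite ler_pM2l.
  have : t ^+ 2 * (e1 * (48 * M)) <= t ^+ 2 * e ^+ 2.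
    by rewrite ler_pM2l // exprn_gt0.
  lra.
exists t, q, g, dq, (c - dq); split => //.
- by apply/andP; split => //; lra.
- by split; lra.
- split; first lra.
  have -> : c - dq - a = (a' - a) - b - dq.
    by rewrite /c; apply/rowP => i; rewrite !mxE; ring.
  have := enormD (a' - a - b) (- dq); have := enormD (a' - a) (- b).
  rewrite !enormN; lra.
- have -> : q + t *: dq = q' by rewrite tdq /x addrC subrK.
  suff -> : g + t *: (c - dq) = g' by [].
  by rewrite scalerBr tdq -eg addrC subrK.
Qed.

(** * Metric regularity and local inversion of the resolvent *)

Lemma normal_pairZ H q g a b (k : R) : 0 < k ->
  normal_pair H q g a b -> normal_pair H q g (k *: a) (k *: b).
Proof.
move=> k0 [Hqg h]; split=> // e e0; have [d d0 hd] := h _ (divr_gt0 e0 k0).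
exists d => // q' g' h' hq hg; have := hd q' g' h' hq hg.
by rewrite !dotZl -mulrDr mulrAC ler_pdivlMr // mulrC.
Qed.

(** Otherwise there are normals [(a, b)] at points tending to [(qb, gb)], scaled to [|a| = 1], with
    [b] tending to 0. By compactness the vectors [a] cluster at a nonzero element of the kernel. *)
Lemma normal_kernel0_bound H qb gb :
  (forall a, normal_kernel H qb gb a -> a = 0) ->
  exists2 r : R, 0 < r & forall q g a b,
    enorm (q - qb) < r -> enorm (g - gb) < r -> normal_pair H q g a b ->
    r * enorm a <= enorm b.
Proof.
move=> H0; apply: contrapT => hno.
pose bad k (w : (('rV[R]_N * 'rV[R]_N) * ('rV[R]_N * 'rV[R]_N))%type) :=
  [/\ enorm (w.1.1 - qb) < k.+1%:R^-1, enorm (w.1.2 - gb) < k.+1%:R^-1,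
      normal_pair H w.1.1 w.1.2 w.2.1 w.2.2, enorm w.2.1 = 1
    & enorm w.2.2 < k.+1%:R^-1].
have /choice[w hw] : forall k, exists w, bad k w.
  move=> k; apply: contrapT => hk; apply: hno.
  exists k.+1%:R^-1 => [|q g a b hq hg hab]; first by rewrite invr_gt0.
  rewrite leNgt; apply/negP => hlt; apply: hk.
  have a0 : 0 < enorm a.
    rewrite lt_neqAle enorm_ge0 andbT; apply/eqP => a0.
    by move: hlt; rewrite -a0 mulr0 ltNge enorm_ge0.
  have ai0 : 0 < (enorm a)^-1 by rewrite invr_gt0.
  exists ((q, g), ((enorm a)^-1 *: a, (enorm a)^-1 *: b)); split=> //=.
  - exact: normal_pairZ.
  - by rewrite enormZ_ge0 ?ltW // mulVf // gt_eqF.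
  - by rewrite enormZ_ge0 ?ltW // mulrC ltr_pdivrMr.
have [a [ha0 hcl]] : [set z | enorm (z - 0) <= 1] `&`
    cluster ((fun k => (w k).2.1) @ \oo) !=set0.
  apply: compact_eball; exists 0%N => // k _ /=.
  by have [_ _ _ h _] := hw k; rewrite subr0 h.
have near_a e : 0 < e -> exists k, k.+1%:R^-1 < e /\ enorm ((w k).2.1 - a) < e.
  move=> e0.
  pose K := Num.trunc e^-1.
  have hK k : (K <= k)%N -> k.+1%:R^-1 < e.
    move=> Kk; rewrite invf_plt ?posrE //.
    by apply: lt_le_trans (truncnS_gt _) _; rewrite ler_nat ltnS.
  have [|//|z [[k Kk <-] hz]] := hcl [set z | exists2 k, (K <= k)%N & (w k).2.1 = z]
      [set z | enorm (z - a) < e].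
  - by exists K => // k /= Kk; exists k.
  - by apply/nbhs_enormP; exists e.
  - by exists k; split => //; exact: hK.
have a0 : a = 0.
  apply: H0 => e e0; have [k [ke ka]] := near_a e e0.
  have [h1 h2 h3 h4 h5] := hw k.
  exists (w k).1.1, (w k).1.2, (w k).2.1, (w k).2.2.
  by split=> //; split=> //; [exact: lt_trans h1 ke|exact: lt_trans h2 ke|exact: lt_trans h5 ke].
have [k [_ hk]] := near_a 1 ltr01.
by have [_ _ _ h _] := hw k; move: hk; rewrite a0 subr0 h ltxx.
Qed.

(** First-order expansion of the norm at [x] with explicit quadratic error, from
    [2 |x| |x + h| <= |x|^2 + |x + h|^2]. *)
Lemma enorm_add_le (x h : 'rV[R]_N) : 0 < enorm x ->
  enorm (x + h) <= enorm x + dot ((enorm x)^-1 *: x) h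
                   + (2 * enorm x)^-1 * enorm h ^+ 2.
Proof.
move=> x0; have xn0 : enorm x != 0 by rewrite gt_eqF.
rewrite dotZl -(ler_pM2l (mulr_gt0 (ltr0n R 2) x0)).
have -> : 2 * enorm x * (enorm x + (enorm x)^-1 * dot x h
    + (2 * enorm x)^-1 * enorm h ^+ 2) =
    2 * enorm x ^+ 2 + 2 * dot x h + enorm h ^+ 2 by field.
have : enorm (x + h) ^+ 2 = enorm x ^+ 2 + 2 * dot x h + enorm h ^+ 2.
  by rewrite !sqr_enorm !dotE (dotC h x); ring.
have := sqr_ge0 (enorm (x + h) - enorm x); lra.
Qed.

(* At a minimizer [p] of [|J p - y| + l |p - p0|^2] with [J p != y], the unit
   vector [c = (J p - y) / |J p - y|] and [b = - 2 l (p - p0)] form the normal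
   [(b - c, b)] to the graph of [G]; a small [b] contradicts [hr]. *)
Lemma resolvent_metric_regularity qb gb (r : R) : 0 < r -> G qb gb ->
  (forall q g a b, enorm (q - qb) < r -> enorm (g - gb) < r ->
     normal_pair G q g a b -> r * enorm a <= enorm b) ->
  exists2 d : R, 0 < d & exists2 L : R, 0 < L &
    forall p0 y, enorm (p0 - (qb + gb)) < d -> enorm (y - J p0) < d ->
    exists2 p, J p = y & enorm (p - p0) <= L * enorm (y - J p0).
Proof.
move=> r0 Gb hr.
(* The normal found below has [|b| <= 2 mu] and [|b - c| >= 1 - 2 mu]; [hmu] makes this contradict
   [hr]. *)
pose mu := r / (4 * (1 + r)).
have mu0 : 0 < mu by rewrite divr_gt0 //; lra.
have hmu : 2 * mu < r * (1 - 2 * mu).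
  have : mu * (4 * (1 + r)) = r by rewrite /mu mulfVK //; lra.
  nra.
clearbody mu.
pose D := r / 3.
have D0 : 0 < D by rewrite divr_gt0.
have h3D : 3 * D = r by rewrite /D; lra.
clearbody D.
exists (Num.min D (mu * D)); first by rewrite lt_min D0 mulr_gt0.
exists mu^-1; first by rewrite invr_gt0.
move=> p0 y; rewrite !lt_min => /andP[hp0 _] /andP[_ hy].
set eta := enorm (y - J p0) in hy *.
have [eta0|eta0] := eqVneq eta 0.
  exists p0; last by rewrite subrr enorm0 eta0 mulr0.
  by apply/esym/subr0_eq/enorm_eq0.
have {eta0}eta_gt0 : 0 < eta by rewrite lt_neqAle eq_sym eta0 enorm_ge0.
(* With this weight, comparing [theta] at the minimizer and at [p0] gives [mu * |p - p0| <= eta],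
   and then [l * |p - p0| <= mu] independently of [eta]. *)
pose l := mu ^+ 2 / eta.
have l0 : 0 < l by rewrite divr_gt0 ?exprn_gt0.
have hl : l * eta = mu ^+ 2 by rewrite /l mulfVK // gt_eqF.
pose theta p := enorm (J p - y) + l * enorm (p - p0) ^+ 2.
have cJ : continuous (fun p => enorm (J p - y)).
  apply: (@lipschitz_enorm_continuous _ _ _ 1) => z z'; rewrite mul1r.
  apply: le_trans (enorm_sub_le _ _) _.
  by rewrite opprB addrA subrK resolvent_nonexpansive.
have ctheta : continuous theta.
  move=> p; have h1 : {for p, continuous (fun z : 'rV[R]_N => enorm (z - p0))}.
    exact: enorm_continuous.
  have h2 := continuousM (@cst_continuous _ _ l p) (continuousM h1 h1).
  exact: (continuousD (cJ p) h2).
have [p pD pmin] : exists2 p, p \in [set z | enorm (z - p0) <= D] &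
    forall t, t \in [set z | enorm (z - p0) <= D] -> theta p <= theta t.
  apply: compact_EVT_min.
  - by exists p0; rewrite /= subrr enorm0 ltW.
  - exact: compact_eball.
  - exact: continuous_subspaceT.
have th0 : theta p <= eta.
  apply: le_trans (pmin p0 _) _; first by rewrite inE /= subrr enorm0 ltW.
  by rewrite /theta subrr enorm0 expr0n mulr0 addr0 enormB.
have pp0 : mu * enorm (p - p0) <= eta.
  have h1 : l * enorm (p - p0) ^+ 2 <= eta.
    by apply: le_trans th0; rewrite lerDr enorm_ge0.
  have : eta * (l * enorm (p - p0) ^+ 2) <= eta * eta by rewrite ler_pM2l.
  rewrite mulrA (mulrC eta l) hl -exprMn -expr2 ler_pXn2r // nnegrE.
    by rewrite mulr_ge0 ?enorm_ge0 // ltW.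
  exact: ltW.
(* The minimizer is interior to the ball, so all points near it are admissible competitors. *)
have pp0D : enorm (p - p0) < D by rewrite -(ltr_pM2l mu0); exact: le_lt_trans pp0 hy.
exists p; last by rewrite -(ler_pM2l mu0) mulrA mulfV ?mul1r // gt_eqF.
apply/subr0_eq/enorm_eq0/eqP; apply: contraT => sg0.
have {sg0}sg0 : 0 < enorm (J p - y) by rewrite lt_neqAle eq_sym sg0 enorm_ge0.
pose c := (enorm (J p - y))^-1 *: (J p - y).
have c1 : enorm c = 1.
  by rewrite enormZ_ge0 ?invr_ge0 ?enorm_ge0 // mulVf // gt_eqF.
pose b := - (2 * l) *: (p - p0).
have hb : enorm b <= 2 * mu.
  rewrite /b scaleNr enormN enormZ_ge0; last by rewrite mulr_ge0 // ltW.
  rewrite -(ler_pM2l eta_gt0).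
  have -> : eta * (2 * l * enorm (p - p0)) = 2 * (l * eta) * enorm (p - p0) by ring.
  by rewrite hl; have := ler_wpM2l (ltW mu0) pp0; lra.
have ha : 1 - 2 * mu <= enorm (b - c).
  have := enormD (c - b) b; rewrite subrK c1 enormB; lra.
have near_b : enorm (p - (qb + gb)) < r.
  by apply: le_lt_trans (enorm_subD p0 _ _) _; lra.
have hJb := resolvent_graph Gb.
have Jnear : enorm (J p - qb) < r.
  by rewrite -[X in _ - X]hJb; apply: le_lt_trans near_b; exact: resolvent_nonexpansive.
have gnear : enorm (p - J p - gb) < r.
  have := co_resolvent_nonexpansive (qb + gb) p.
  rewrite hJb [qb + gb - qb]addrC addKr => h; exact: le_lt_trans h near_b.
suff nab : normal_pair G (J p) (p - J p) (b - c) b.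
  have := hr _ _ _ _ Jnear gnear nab.
  have := ler_wpM2l (ltW r0) ha; lra.
split=> [|e e0]; first exact: resolventP.
(* [C] collects the quadratic errors of the norm term and of the penalty; [d] makes them at most [e]
   times the displacement. *)
pose C := (2 * enorm (J p - y))^-1 + l.
have C0 : 0 < C by rewrite addr_gt0 // invr_gt0 mulr_gt0.
pose d := Num.min ((D - enorm (p - p0)) / 2) (e / (2 * C)).
have d0 : 0 < d by rewrite lt_min !divr_gt0 ?subr_gt0 ?mulr_gt0.
have d1 : d * 2 <= D - enorm (p - p0).
  by rewrite -ler_pdivlMr ?ge_min ?lexx ?orbT.
have d2 : d * (2 * C) <= e.
  by rewrite -ler_pdivlMr ?ge_min ?lexx ?orbT // mulr_gt0.
clearbody d.
exists d => // q' g' Gq' hq hg.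
(* Each graph point [(q', g')] is reached by the competitor [p' = q' + g'], whose resolvent is
   [q']. *)
pose p' := q' + g'.
have Jp' : J p' = q' by exact: resolvent_graph.
set x := q' - J p in hq *; set z := g' - (p - J p) in hg *.
have pxz : p' - p = x + z by rewrite /p' /x /z; apply/rowP => i; rewrite !mxE; ring.
have nxz := enormD x z; have x_ge0 := enorm_ge0 x; have z_ge0 := enorm_ge0 z.
have p'D : enorm (p' - p0) <= D.
  by apply: le_trans (enorm_subD p _ _) _; rewrite pxz; lra.
have := pmin p'; rewrite inE /theta => /(_ p'D).
have -> : J p' - y = (J p - y) + x.
  by rewrite Jp' /x; apply/rowP => i; rewrite !mxE; ring.
have -> : p' - p0 = (p - p0) + (x + z).
  by rewrite -pxz; apply/rowP => i; rewrite !mxE; ring.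
have := enorm_add_le x sg0; rewrite -/c => h1 h2.
have h3 : enorm (p - p0 + (x + z)) ^+ 2 =
    enorm (p - p0) ^+ 2 + 2 * dot (p - p0) (x + z) + enorm (x + z) ^+ 2.
  by move: (p - p0) (x + z) => s t; rewrite !sqr_enorm !dotE (dotC t s); ring.
have h4 : 0 <= dot c x + (2 * enorm (J p - y))^-1 * enorm x ^+ 2
    + l * (2 * dot (p - p0) (x + z) + enorm (x + z) ^+ 2).
  by move: h2; rewrite h3; move: h1; lra.
have -> : dot (b - c) x + dot b z =
    - (dot c x) - 2 * l * dot (p - p0) (x + z).
  by rewrite /b; move: (p - p0) => s; rewrite !dotE; ring.
have h5 : (2 * enorm (J p - y))^-1 * enorm x ^+ 2 <=
    (2 * enorm (J p - y))^-1 * (enorm x + enorm z) ^+ 2.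
  by rewrite ler_pM2l ?invr_gt0 ?mulr_gt0 // ler_pXn2r ?nnegrE ?addr_ge0 // lerDl.
have h6 : l * enorm (x + z) ^+ 2 <= l * (enorm x + enorm z) ^+ 2.
  by rewrite ler_pM2l // ler_pXn2r ?nnegrE ?addr_ge0 ?enorm_ge0.
have h7 : C * (enorm x + enorm z) ^+ 2 <= e * (enorm x + enorm z).
  have s2d : enorm x + enorm z <= 2 * d by lra.
  have : C * (enorm x + enorm z) <= e by nra.
  by move/(ler_wpM2r (addr_ge0 x_ge0 z_ge0)); rewrite expr2 mulrA.
by move: h7; rewrite {1}/C; move: h4 h5 h6; lra.
Qed.
(** If [J p1 = J p2] and [v = p2 - p1] is nonzero, regularity solves [J p' = J p1 + t v] with
    [|p' - p1| <= L t |v|]. For small [t] the term [- |v|^2] then violates monotonicity between [p2]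
    and [p']. *)
Lemma resolvent_inj_near p0 (d L : R) : 0 < d -> 0 < L ->
  (forall p y, enorm (p - p0) < d -> enorm (y - J p) < d ->
    exists2 p', J p' = y & enorm (p' - p) <= L * enorm (y - J p)) ->
  forall p1 p2, enorm (p1 - p0) < d -> J p1 = J p2 -> p1 = p2.
Proof.
move=> d0 L0 hJ p1 p2 h1 J12; apply: contrapT => /eqP p12.
have n0 : 0 < enorm (p2 - p1) by rewrite enorm_gt0 // subr_eq0 eq_sym.
set v := p2 - p1 in n0 *.
pose t := Num.min (d / (2 * enorm v)) (2 * L)^-1.
have t0 : 0 < t by rewrite lt_min divr_gt0 ?invr_gt0 ?mulr_gt0.
have t1 : t * (2 * enorm v) <= d.
  by rewrite -ler_pdivlMr ?ge_min ?lexx // mulr_gt0.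
have t2 : t * (2 * L) <= 1.
  by rewrite -ler_pdivlMr ?mulr_gt0 // div1r ge_min lexx orbT.
clearbody t.
have ty : enorm (J p1 + t *: v - J p1) = t * enorm v.
  by rewrite addrC addKr enormZ_ge0 // ltW.
have [|p' Jp' hp'] := hJ p1 (J p1 + t *: v) h1; first by rewrite ty; nra.
have := monG (resolventP p2) (resolventP p').
have -> : J p' - J p2 = t *: v by rewrite Jp' J12 addrC addKr.
have -> : p' - J p' - (p2 - J p2) = (p' - p1) - v - t *: v.
  by rewrite Jp' J12 /v; apply/rowP => i; rewrite !mxE; ring.
rewrite dotZr pmulr_rge0 //.
move: hp'; rewrite ty => hp'; move: (dot_le (p' - p1) v); clearbody v.
have : 0 < enorm v ^+ 2 by rewrite exprn_gt0.
move: (p' - p1) hp' => w hw; rewrite !dotE -sqr_enorm.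
have := ler_wpM2r (enorm_ge0 v) hw; nra.
Qed.

Lemma lipschitz_localization_resolvent qb gb : G qb gb ->
  (forall a, normal_kernel G qb gb a -> a = 0) ->
  lipschitz_localization G qb gb.
Proof.
move=> Gb /normal_kernel0_bound[r r0 hr].
have [d d0 [L L0 hJ]] := resolvent_metric_regularity r0 Gb hr.
have hJb := resolvent_graph Gb.
(* The solution [p] below is within [2 * (L + 1) * rho = d / 2] of [qb + gb], where injectivity of
   [J] identifies it with [q2 + g2]. *)
pose rho := d / (4 * (L + 1)).
have rho0 : 0 < rho by rewrite divr_gt0 // mulr_gt0 //; lra.
have hrho : rho * (4 * (L + 1)) = d by rewrite /rho mulfVK // gt_eqF //; lra.
clearbody rho.
exists rho => //; exists (L + 1); first lra.
split=> [q hq|q1 g1 q2 g2 G1 G2 hq1 hg1 hq2 hg2].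
  have [||p Jp hp] := hJ (qb + gb) q; first by rewrite subrr enorm0.
    by rewrite hJb; nra.
  exists (p - q); first by have := resolventP p; rewrite Jp.
  have -> : p - q - gb = (p - (qb + gb)) - (q - qb).
    by apply/rowP => i; rewrite !mxE; ring.
  by apply: le_trans (enormD _ _) _; rewrite enormN mulrDl mul1r lerD2r -[in leRHS]hJb.
have hp q g : enorm (q - qb) < rho -> enorm (g - gb) < rho ->
    enorm (q + g - (qb + gb)) < 2 * rho.
  move=> h1 h2; rewrite opprD addrACA.
  by apply: le_lt_trans (enormD _ _) _; lra.
have q12 : enorm (q2 - q1) < 2 * rho.
  by apply: le_lt_trans (enorm_subD qb _ _) _; rewrite (enormB qb); lra.
have [||p Jp hpL] := hJ (q1 + g1) q2.
- by apply: lt_le_trans (hp _ _ hq1 hg1) _; nra.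
- by rewrite (resolvent_graph G1); nra.
have pE : p = q2 + g2.
  apply: (resolvent_inj_near d0 L0 hJ); last by rewrite Jp (resolvent_graph G2).
  apply: le_lt_trans (enorm_subD (q1 + g1) _ _) _.
  have := hp _ _ hq1 hg1; move: hpL; rewrite (resolvent_graph G1); nra.
move: hpL; rewrite pE (resolvent_graph G1) => hpL.
have -> : g1 - g2 = - (q2 + g2 - (q1 + g1)) + (q2 - q1).
  by apply/rowP => i; rewrite !mxE; ring.
by apply: le_trans (enormD _ _) _; rewrite enormN (enormB q1) mulrDl mul1r lerD2r.
Qed.

End MonotoneResolvent.

(** * Invariance of the criteria under a linear shear *)

Lemma mulmx_enorm_bound A : exists2 s : R, 0 < s &
  forall a, enorm (a *m A) <= s * enorm a.
Proof.
pose s := \sum_(i < N) enorm (row i A).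
exists (s + 1) => [|a]; first by rewrite ltr_wpDl // sumr_ge0 // => i _; exact: enorm_ge0.
apply: (@le_trans _ _ (s * enorm a)); last by rewrite ler_wpM2r ?enorm_ge0 ?lerDl.
rewrite mulmx_sum_row mulr_suml.
elim/big_rec2: _ => [|i y z _ hyz]; first by rewrite enorm0.
apply: le_trans (enormD _ _) _; apply: lerD hyz.
rewrite enormZ mulrC ler_wpM2l ?enorm_ge0 //.
exact: le_trans (normr_coord _ _) (normr_le_enorm _).
Qed.

Lemma dot_mulmx A a b : dot (a *m A) b = dot a (b *m A^T).
Proof.
have dotM (c e : 'rV[R]_N) : dot c e = (c *m e^T) 0 0.
  by rewrite mxE; apply: eq_bigr => i _; rewrite mxE.
by rewrite !dotM trmx_mul trmxK mulmxA.
Qed.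

Definition sheared A H G qb gb := exists2 r : R, 0 < r & forall q g,
  enorm (q - qb) < r -> enorm (g - gb) < r -> H q g <-> G q (g + q *m A).

Lemma shearB A q g q' g' :
  g + q *m A - (g' + q' *m A) = (g - g') + (q - q') *m A.
Proof. by rewrite mulmxBl opprD addrACA. Qed.

Lemma sheared_sym A H G qb gb :
  sheared A H G qb gb -> sheared (- A) G H qb (gb + qb *m A).
Proof.
move=> [r r0 hr]; have [s s0 hs] := mulmx_enorm_bound A.
have rs : r / (1 + s) * (1 + s) = r by rewrite mulfVK // gt_eqF //; lra.
exists (r / (1 + s)) => [|q g hq hg]; first by rewrite divr_gt0 //; lra.
have -> : G q g <-> G q ((g + q *m - A) + q *m A) by rewrite mulmxN subrK.
apply: iff_sym; apply: hr; first by nra.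
have -> : g + q *m - A - gb = (g - (gb + qb *m A)) - (q - qb) *m A.
  by rewrite mulmxN mulmxBl; apply/rowP => i; rewrite !mxE; ring.
apply: le_lt_trans (enormD _ _) _; rewrite enormN; have := hs (q - qb); nra.
Qed.

(** The shear acts on normals by the inverse transpose, sending [(a', b)] to [(a' - b *m A^T, b)];
    as [b] tends to 0, the limit [a] is unchanged. *)
Lemma normal_kernel_sheared A H G qb gb a : sheared A H G qb gb ->
  normal_kernel H qb gb a -> normal_kernel G qb (gb + qb *m A) a.
Proof.
move=> [r r0 hr] ha e e0.
have [s s0 hs] := mulmx_enorm_bound A; have [s' s'0 hs'] := mulmx_enorm_bound A^T.
pose e1 := Num.min (e / (1 + s + s')) (r / 2).
have e10 : 0 < e1 by rewrite lt_min !divr_gt0 //; lra.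
have e11 : e1 * (1 + s + s') <= e.
  by rewrite -ler_pdivlMr ?ge_min ?lexx //; lra.
have e12 : e1 <= r / 2 by rewrite ge_min lexx orbT.
clearbody e1.
have [q [g [a' [b [[hq hg] [haa hb] [Hqg nab]]]]]] := ha e1 e10.
have hs1 := hs (q - qb); have hs2 := hs' b.
exists q, (g + q *m A), (a' - b *m A^T), b; split.
- split; first nra.
  by rewrite shearB; apply: le_lt_trans (enormD _ _) _; nra.
- split; last nra.
  rewrite addrAC; apply: le_lt_trans (enormD _ _) _; rewrite enormN; nra.
split=> [|f f0]; first by apply/hr => //; lra.
(* Undoing the shear enlarges the sum of the two displacements by a factor of at most [1 + s]. *)
have [d d0 hd] := nab (f / (1 + s)) (divr_gt0 f0 (ltr_pwDl ltr01 (ltW s0))).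
pose d1 := Num.min d (r / 2) / (1 + s).
have hd1 : d1 * (1 + s) = Num.min d (r / 2) by rewrite /d1 mulfVK // gt_eqF //; lra.
have d10 : 0 < d1 by rewrite divr_gt0 ?lt_min ?d0 ?divr_gt0 //; lra.
have hm1 : Num.min d (r / 2) <= d by rewrite ge_min lexx.
have hm2 : Num.min d (r / 2) <= r / 2 by rewrite ge_min lexx orbT.
rewrite -hd1 in hm1 hm2; clearbody d1.
exists d1 => // q' g' Gq' hq' hg'.
pose g1 := g' - q' *m A.
have g'E : g' = g1 + q' *m A by rewrite subrK.
rewrite g'E shearB in Gq' hg' *.
have n1 : enorm (g1 - g) <= enorm (g1 - g + (q' - q) *m A) + s * enorm (q' - q).
  have := enormD (g1 - g + (q' - q) *m A) (- ((q' - q) *m A)).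
  by rewrite addrK enormN; have := hs (q' - q); lra.
have qn := enorm_ge0 (q' - q).
have Hq' : H q' g1.
  apply/hr => //.
    by apply: le_lt_trans (enorm_subD q _ _) _; nra.
  by apply: le_lt_trans (enorm_subD g _ _) _; nra.
have := hd _ _ Hq' _ _; move=> /(_ _ _)/wrap[]; [nra|nra|] => h.
have -> : dot (a' - b *m A^T) (q' - q) + dot b (g1 - g + (q' - q) *m A)
    = dot a' (q' - q) + dot b (g1 - g).
  by rewrite (dotDr _ _ b) (dotC b (_ *m A)) dot_mulmx dotDl dotNl
     [dot (q' - q) (b *m _)]dotC; ring.
apply: le_trans h _; rewrite -mulrA ler_pM2l // mulrC ler_pdivrMr; last lra.
move: n1 qn (enorm_ge0 (g1 - g + (q' - q) *m A)).
by move: (enorm (g1 - g)) (enorm (q' - q)) (enorm _) => x y z; nra.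
Qed.

(** Directions become [(dq, dg + dq *m A)], and the correction vanishes because [dq] tends to 0. *)
Lemma tangent_kernel_sheared A H G qb gb a : sheared A H G qb gb ->
  tangent_kernel H qb gb a -> tangent_kernel G qb (gb + qb *m A) a.
Proof.
move=> [r r0 hr] ha e e0.
have [s s0 hs] := mulmx_enorm_bound A.
pose M := 2 + s + enorm a.
have M1 : 2 < M by rewrite /M; have := enorm_ge0 a; lra.
pose e1 := Num.min 1 (Num.min e r / M).
have e10 : 0 < e1 by rewrite !lt_min ltr01 !divr_gt0 ?lt_min ?e0 ?r0 //; lra.
have e11 : e1 <= 1 by rewrite ge_min lexx.
have e12 : e1 * M <= Num.min e r.
  by rewrite -ler_pdivlMr ?ge_min ?lexx ?orbT //; lra.
have e13 : e1 * M <= e by apply: le_trans e12 _; rewrite ge_min lexx.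
have e14 : e1 * M <= r by apply: le_trans e12 _; rewrite ge_min lexx orbT.
clearbody e1.
have [t [q [g [dq [dg [/andP[t0 te] [hq hg] [hdq hdg] h1 h2]]]]]] := ha _ e10.
have hs1 := hs (q - qb); have hs2 := hs dq.
have a0 := enorm_ge0 a.
have Me : e1 * (1 + s) <= e1 * M by rewrite ler_pM2l // /M; lra.
have Me2 : e1 * (2 + enorm a) <= e1 * M by rewrite ler_pM2l // /M; lra.
have Me3 : e1 * 2 <= e1 * M by rewrite ler_pM2l // /M; lra.
exists t, q, (g + q *m A), dq, (dg + dq *m A); split.
- by apply/andP; split => //; lra.
- split; first lra.
  by rewrite shearB; apply: le_lt_trans (enormD _ _) _; nra.
- split; first lra.
  by rewrite addrAC; apply: le_lt_trans (enormD _ _) _; nra.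
- by apply/hr => //; lra.
have -> : g + q *m A + t *: (dg + dq *m A) = (g + t *: dg) + (q + t *: dq) *m A.
  by rewrite scalerDr mulmxDl -scalemxAl addrACA.
apply/hr => //.
  rewrite addrAC; apply: le_lt_trans (enormD _ _) _.
  by rewrite enormZ_ge0 ?(ltW t0) //; have := enorm_ge0 dq; nra.
rewrite addrAC; apply: le_lt_trans (enormD _ _) _.
have := enormD (dg - a) a; rewrite subrK enormZ_ge0 ?(ltW t0) //.
have := enorm_ge0 dg; nra.
Qed.

Lemma lipschitz_localization_sheared A H G qb gb : sheared A H G qb gb ->
  lipschitz_localization H qb gb ->
  lipschitz_localization G qb (gb + qb *m A).
Proof.
move=> HG [r0' r0'0 [L L0 [Hex Hlip]]].
have [r r0 hr] := HG.
have [r' r'0 hr'] := sheared_sym HG.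
have [s s0 hs] := mulmx_enorm_bound A.
pose M := 1 + L + s.
have M0 : 0 < M by rewrite /M; lra.
pose rho := Num.min (Num.min r0' r') r / M.
have rho0 : 0 < rho by rewrite divr_gt0 // !lt_min r0 r'0 r0'0.
have rhoM : rho * M = Num.min (Num.min r0' r') r by rewrite mulfVK // gt_eqF.
have hm1 : rho * M <= r0' by rewrite rhoM !ge_min lexx.
have hm2 : rho * M <= r' by rewrite rhoM !ge_min lexx orbT.
have hm3 : rho * M <= r by rewrite rhoM !ge_min lexx orbT.
clearbody rho.
have rM : rho <= rho * M by rewrite ler_peMr // ?ltW // /M; lra.
have rM2 : rho * (L + 1) <= rho * M by rewrite ler_pM2l // /M; lra.
have rM3 : rho * (s + 1) <= rho * M by rewrite ler_pM2l // /M; lra.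
exists rho => //; exists M => //; split=> [q hq|q1 g1 q2 g2 G1 G2 hq1 hg1 hq2 hg2].
  have [|g Hqg hg] := Hex q; first lra.
  have qn := enorm_ge0 (q - qb).
  exists (g + q *m A); first by apply/hr => //; [lra|nra].
  rewrite shearB; apply: le_trans (enormD _ _) _.
  by have := hs (q - qb); rewrite /M; nra.
have back q g : G q g -> enorm (q - qb) < rho ->
    enorm (g - (gb + qb *m A)) < rho ->
    H q (g + q *m - A) /\ enorm (g + q *m - A - gb) < r0'.
  move=> Gqg hq hg; split; first by apply/hr' => //; lra.
  have -> : g + q *m - A - gb = (g - (gb + qb *m A)) - (q - qb) *m A.
    by rewrite mulmxN mulmxBl; apply/rowP => i; rewrite !mxE; ring.
  apply: le_lt_trans (enormD _ _) _; rewrite enormN; have := hs (q - qb); nra.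
have [H1 k1] := back _ _ G1 hq1 hg1; have [H2 k2] := back _ _ G2 hq2 hg2.
have := Hlip _ _ _ _ H1 H2 _ k1 _ k2; move=> /(_ _ _)/wrap[]; [lra|lra|].
rewrite shearB => h.
have := enormD (g1 - g2 + (q1 - q2) *m - A) ((q1 - q2) *m A).
rewrite mulmxN subrK -mulmxN; have := hs (q1 - q2).
have := enorm_ge0 (q1 - q2); rewrite /M; nra.
Qed.

(** Only [G] is assumed monotone: the normal is sheared to [G], becomes a tangent there, and the
    inverse shear brings it back. *)
Lemma normal_kernel_tangent_sheared A H G qb gb a :
  monotone G -> resolvent_onto G -> sheared A H G qb gb ->
  normal_kernel H qb gb a -> tangent_kernel H qb gb a.
Proof.
move=> monG ontoG HG /(normal_kernel_sheared HG).
move=> /(normal_kernel_tangent monG ontoG)/(tangent_kernel_sheared (sheared_sym HG)).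
by rewrite mulmxN addrK.
Qed.

Lemma lipschitz_localization_sheared_resolvent A H G qb gb :
  monotone G -> resolvent_onto G -> sheared A H G qb gb -> H qb gb ->
  (forall a, normal_kernel H qb gb a -> a = 0) ->
  lipschitz_localization H qb gb.
Proof.
move=> monG ontoG HG Hb H0; have [r r0 hr] := HG.
suff : lipschitz_localization G qb (gb + qb *m A).
  by move/(lipschitz_localization_sheared (sheared_sym HG)); rewrite mulmxN addrK.
apply: (lipschitz_localization_resolvent monG ontoG).
  by apply/hr => //; rewrite subrr enorm0.
move=> a /(normal_kernel_sheared (sheared_sym HG)).
by rewrite mulmxN addrK; exact: H0.
Qed.

End Relations.

(** * Subgradients of convex functions *)

Section LowerSemicontinuity.
Variable R : realType.

Lemma ereal_real_between (x y : \bar R) : (x < y)%E ->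
  exists a : R, (x < a%:E)%E /\ (a%:E < y)%E.
Proof.
case: x y => [r||] [s||] //= xy.
- exists ((r + s) / 2); rewrite !lte_fin in xy *; split; lra.
- by exists (r + 1); rewrite ltry lte_fin; split => //; lra.
- by exists (s - 1); rewrite ltNyr lte_fin; split => //; lra.
- by exists 0; rewrite ltNyr ltry.
Qed.

(** Weierstrass: a minimizer is a cluster point of the filter of sublevel sets above the infimum. If
    the infimum is infinite, [f] is constantly infinite on [K]. *)
Lemma lower_semicontinuous_min (T : topologicalType) (f : T -> \bar R) (K : set T) :
  K !=set0 -> compact K -> lower_semicontinuous f ->
  exists2 z, K z & forall z', K z' -> (f z <= f z')%E.
Proof.
move=> [z0 Kz0] cK lscf.
pose I := ereal_inf [set f z | z in K].
have Ile z : K z -> (I <= f z)%E by move=> Kz; apply: ereal_inf_lbound; exists z.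
have [Ioo|Ioo] := leP +oo%E I.
  exists z0 => // z' /Ile; rewrite leye_eq in Ioo; rewrite (eqP Ioo) leye_eq => /eqP ->.
  by rewrite leey.
pose F := filter_from [set a : R | (I < a%:E)%E]
  (fun a => [set z | K z /\ (f z < a%:E)%E]).
have FF : Filter F.
  apply: filter_from_filter.
    by have [a [Ia _]] := ereal_real_between Ioo; exists a.
  move=> a b /= Ia Ib; exists (Num.min a b).
    by rewrite /= EFin_min lt_min Ia Ib.
  by move=> z /= []; rewrite EFin_min lt_min => Kz /andP[].
have PF : ProperFilter F.
  apply: filter_from_proper => a /= /ereal_inf_lt[_ [z Kz <-] za].
  by exists z.
have FK : F K.
  by have [a [Ia _]] := ereal_real_between Ioo; exists a => // z [].
have [z [Kz clz]] := cK _ PF FK.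
exists z => // z' /Ile; apply: le_trans; rewrite leNgt; apply/negP.
move=> /ereal_real_between[a [Ia az]]; have [V Vz Vf] := lscf z a az.
have Fa : F [set z | K z /\ (f z < a%:E)%E] by exists a.
have [y [[_ ya] /Vf]] := clz _ _ Fa Vz.
by rewrite ltNge (ltW ya).
Qed.

Lemma lower_semicontinuousD (T : topologicalType) (f : T -> \bar R) (h : T -> R) :
  (forall z, f z != -oo%E) -> lower_semicontinuous f -> continuous h ->
  lower_semicontinuous (fun z => (f z + (h z)%:E)%E).
Proof.
move=> fNy lscf ch z a afh.
have /ereal_real_between[b [ab bf]] : ((a - h z)%:E < f z)%E.
  move: (fNy z) afh; case: (f z) => [r||] // _; last by move=> _; rewrite ltry.
  by rewrite -EFinD !lte_fin; lra.
have [V Vz Vf] := lscf z b bf.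
exists (V `&` [set y | a - b < h y]).
  apply: filterI => //; apply: (ch z [set t | a - b < t]); apply: lt_nbhsr.
  by move: ab; rewrite lte_fin; lra.
move=> y [/Vf bfy /= aby].
move: bfy; case: (f y) => [r||] //; last by move=> _; rewrite addye // ltry.
by rewrite -EFinD !lte_fin; lra.
Qed.

End LowerSemicontinuity.

Section ConvexSubgradients.
Variables (R : realType) (N : nat).
Implicit Types (f psi : 'rV[R]_N -> \bar R) (z w p : 'rV[R]_N).

(** The global subgradient inequality of convex analysis, shown below to agree with [subgradient]
    for convex functions that avoid the value minus infinity. *)
Definition supports f z w := f z \is a fin_num /\
  forall z', (f z + (dot w (z' - z))%:E <= f z')%E.

Lemma regular_subgradient_subgradient f z w :
  regular_subgradient f z w -> subgradient f z w.
Proof.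
move=> hw; split; first by have [] := hw.
by exists (fun=> z), (fun=> w); split=> //; exact: cvg_cst.
Qed.

Lemma supports_regular_subgradient f z w (d c : R) : f z \is a fin_num -> 0 < d ->
  (forall z', enorm (z' - z) < d ->
     (f z + (dot w (z' - z) - c * enorm (z' - z) ^+ 2)%:E <= f z')%E) ->
  regular_subgradient f z w.
Proof.
move=> fz d0 h; split=> // e e0; apply/nbhs_enormP.
have c0 : 0 < `|c| + 1 by rewrite ltr_wpDl.
exists (Num.min d (e / (`|c| + 1))) => [|z']; first by rewrite lt_min d0 divr_gt0.
rewrite lt_min => /andP[zd]; rewrite ltr_pdivlMr // => ze.
apply: le_trans (h z' zd); rewrite -(fineK fz) -!EFinD lee_fin !lerD2l lerN2.
have := enorm_ge0 (z' - z); have := ler_norm c.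
by move: (enorm _) ze => x; nra.
Qed.

Lemma supports_subgradient f z w : supports f z w -> subgradient f z w.
Proof.
move=> [fz h]; apply: regular_subgradient_subgradient.
apply: (@supports_regular_subgradient _ _ _ 1 0) => // z' _.
by rewrite mul0r subr0.
Qed.

(** Convexity bounds the difference quotients on the segment from [z] to [z'] by [psi z' - psi z],
    so a strict violation at [z'] would persist near [z], beyond the first-order error. *)
Lemma regular_subgradient_supports psi z w :
  (forall z', psi z' != -oo%E) -> convex_on setT psi ->
  regular_subgradient psi z w -> supports psi z w.
Proof.
move=> psiNy cvx [fz h]; split=> // z'.
have [a za] : exists a, psi z = a%:E by exists (fine (psi z)); rewrite fineK.
case zb : (psi z') (psiNy z') => [b||] // _; last by rewrite leey.
rewrite za -EFinD lee_fin leNgt; apply/negP => hlt.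
set v := z' - z in hlt *; have v0 := enorm_ge0 v.
pose e := (a + dot w v - b) / (2 * (enorm v + 1)).
have e0 : 0 < e by rewrite divr_gt0 ?mulr_gt0 //; lra.
have he : e * (2 * (enorm v + 1)) = a + dot w v - b.
  by rewrite /e mulfVK // gt_eqF // mulr_gt0 //; lra.
have /nbhs_enormP[d d0 hd] := h e e0.
pose t := Num.min 1 (d / (2 * (enorm v + 1))).
have t0 : 0 < t by rewrite lt_min ltr01 divr_gt0 ?mulr_gt0 //; lra.
have t1 : t <= 1 by rewrite ge_min lexx.
have t2 : t * (2 * (enorm v + 1)) <= d.
  by rewrite -ler_pdivlMr ?ge_min ?lexx ?orbT // mulr_gt0 //; lra.
clearbody t e.
have zt : t *: z' + (1 - t) *: z = z + t *: v.
  by rewrite /v; apply/rowP => i; rewrite !mxE; ring.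
have := cvx z' z t I I; rewrite (ltW t0) t1 => /(_ isT).
rewrite zt za zb -!EFinM -EFinD => hcv.
have /hd : enorm (z + t *: v - z) < d.
  by rewrite addrC addKr enormZ_ge0 ?(ltW t0) //; nra.
move=> /(fun H => le_trans H hcv); rewrite za -EFinD lee_fin.
rewrite [z + _ - z]addrC addKr dotZr enormZ_ge0 ?(ltW t0) // => hfin.
have : t * (e * enorm v - (a + dot w v - b)) >= 0 by lra.
by rewrite pmulr_rge0 //; nra.
Qed.

Lemma subgradient_supports psi z w :
  (forall z', psi z' != -oo%E) -> convex_on setT psi ->
  subgradient psi z w -> supports psi z w.
Proof.
move=> psiNy cvx [fz [z_ [w_ [hz hf hw hr]]]]; split=> // z'.
have {hr}hs k := regular_subgradient_supports psiNy cvx (hr k).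
have [a za] : exists a, psi z = a%:E by exists (fine (psi z)); rewrite fineK.
case zb : (psi z') (psiNy z') => [b||] // _; last by rewrite leey.
rewrite za in hf *; rewrite -EFinD lee_fin leNgt; apply/negP => hlt.
move: hf => /fine_cvgP[_ hf].
set M := enorm (z' - z) + enorm w + 1.
have M0 : 1 <= M by rewrite /M; have := enorm_ge0 (z' - z); have := enorm_ge0 w; lra.
(* Passing to the limit costs at most [e * (|z' - z| + |w| + 2)], which is at most [2 * M * e], half
   of the assumed gap. *)
pose e := Num.min 1 ((a + dot w (z' - z) - b) / (4 * M)).
have e0 : 0 < e by rewrite lt_min ltr01 divr_gt0 ?mulr_gt0 //; lra.
have e1 : e <= 1 by rewrite ge_min lexx.
have e2 : e * (4 * M) <= a + dot w (z' - z) - b.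
  by rewrite -ler_pdivlMr ?ge_min ?lexx ?orbT // mulr_gt0 //; lra.
clearbody e.
have [K1 hK1] := (cvg_enormP _ _).1 hz e e0.
have [K2 hK2] := (cvg_enormP _ _).1 hw e e0.
have [K3 _ hK3] := cvgr_dist_lt _ _ hf _ e0.
pose k := maxn K1 (maxn K2 K3).
have k1 := hK1 k (leq_maxl _ _).
have k2 : enorm (w_ k - w) < e by apply: hK2; rewrite !leq_max leqnn orbT.
have k3 : `|a - fine (psi (z_ k))| < e by apply: hK3; rewrite /= !leq_max leqnn !orbT.
have [fk /(_ z')] := hs k; rewrite zb -(fineK fk) -EFinD lee_fin.
have -> : z' - z_ k = (z' - z) - (z_ k - z) by apply/rowP => i; rewrite !mxE; ring.
rewrite -[w_ k](subrK w); move: e2 hlt k1 k2 k3; rewrite /M ltr_norml.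
move: (z' - z) (w_ k - w) (z_ k - z) (fine _) => v dw dz c e2 hlt k1 k2 /andP[k3 k4].
rewrite !dotE; have := dot_ge dw v; have := dot_le dw dz; have := dot_le w dz.
have n1 := enorm_ge0 dw; have n2 := enorm_ge0 dz; have n3 := enorm_ge0 w.
have n4 := enorm_ge0 v.
have : enorm dw * enorm v <= e * enorm v by rewrite ler_wpM2r // ltW.
have : enorm dw * enorm dz <= e * 1 by apply: ler_pM => //; lra.
have : enorm w * enorm dz <= enorm w * e by rewrite ler_wpM2l // ltW.
have := mulr_ge0 (ltW e0) n3; have := mulr_ge0 (ltW e0) n4; lra.
Qed.

(* Minty: [p - z] is a subgradient at the minimizer [z] of
   [psi + |. - p|^2 / 2]. *)
Lemma convex_prox psi z0 w0 :
  (forall z', psi z' != -oo%E) -> convex_on setT psi ->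
  lower_semicontinuous psi -> supports psi z0 w0 ->
  forall p, exists z, supports psi z (p - z).
Proof.
move=> psiNy cvx lsc [fz0 h0] p.
pose h z : R := 2^-1 * enorm (z - p) ^+ 2.
have ch : continuous h.
  move=> x; have h1 : {for x, continuous (fun z : 'rV[R]_N => enorm (z - p))}.
    exact: enorm_continuous.
  exact: (continuousM (@cst_continuous _ _ (2^-1 : R) x) (continuousM h1 h1)).
have n1 := enorm_ge0 w0; have n2 := enorm_ge0 (z0 - p).
(* By the affine minorant of slope [w0], the objective outside this ball is at least its value at
   [z0], a point of the ball; so a minimizer on the ball is global. *)
pose rho := 2 * enorm w0 + 2 * enorm (z0 - p) + 1.
have rho0 : 0 < rho by rewrite /rho; lra.
have [z zK zmin] : exists2 z, enorm (z - p) <= rho & forall z', enorm (z' - p) <= rho ->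
    (psi z + (h z)%:E <= psi z' + (h z')%:E)%E.
  apply: (@lower_semicontinuous_min _ _ (fun z => psi z + (h z)%:E)%E
    [set z | enorm (z - p) <= rho]).
  - by exists p; rewrite /= subrr enorm0 ltW.
  - exact: compact_eball.
  - exact: lower_semicontinuousD.
have {}zmin z' : (psi z + (h z)%:E <= psi z' + (h z')%:E)%E.
  have [|far] := leP (enorm (z' - p)) rho; first exact: zmin.
  apply: le_trans (zmin z0 _) _; first by rewrite /rho; lra.
  case: (psi z') (psiNy z') (h0 z') => [b||] // _; last by move=> _; rewrite addye // leey.
  rewrite -(fineK fz0) -!EFinD !lee_fin => hb.
  have := dot_ge w0 (z' - z0); have := enorm_subD p z' z0; rewrite (enormB p z0).
  have n3 := enorm_ge0 (z' - z0) => h1 h2.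
  have : enorm w0 * enorm (z' - z0) <= enorm w0 * (enorm (z' - p) + enorm (z0 - p)).
    by rewrite ler_wpM2l.
  move: far; rewrite /h /rho; nra.
have fz : psi z \is a fin_num.
  have := zmin z0; rewrite -(fineK fz0) -EFinD.
  by case: (psi z) (psiNy z).
exists z; apply: regular_subgradient_supports => //.
apply: (@supports_regular_subgradient _ _ _ 1 (1 / 2)) => // z' _.
have := zmin z'; case: (psi z') (psiNy z') => [b||] // _; last by move=> _; rewrite leey.
rewrite -(fineK fz) -!EFinD !lee_fin.
have : h z' = h z - dot (p - z) (z' - z) + enorm (z' - z) ^+ 2 / 2.
  have -> : dot (p - z) (z' - z) = - dot (z - p) (z' - z) by rewrite -dotNl opprB.
  rewrite /h; have -> : z' - p = (z - p) + (z' - z) by apply/rowP => i; rewrite !mxE; ring.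
  move: (z - p) (z' - z) => a b'; rewrite !sqr_enorm !dotE (dotC b' a); lra.
lra.
Qed.

End ConvexSubgradients.

(** * Partial inversion *)

Section EnormRow.
Variables (R : realType) (n m : nat).
Implicit Types (a b c d : 'rV[R]_(n + m)).

Lemma dot_row_mx (x x' : 'rV[R]_n) (u u' : 'rV[R]_m) :
  dot (row_mx x u) (row_mx x' u') = dot x x' + dot u u'.
Proof.
rewrite /dot big_split_ord; congr (_ + _); apply: eq_bigr => i _.
  by rewrite !row_mxEl.
by rewrite !row_mxEr.
Qed.

Lemma enorm_lsubmx a : enorm (lsubmx a) <= enorm a.
Proof.
rewrite -(@ler_pXn2r _ 2) ?nnegrE ?enorm_ge0 // !sqr_enorm.
by rewrite -{3 4}(hsubmxK a) dot_row_mx lerDl dot_ge0.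
Qed.

Lemma enorm_rsubmx a : enorm (rsubmx a) <= enorm a.
Proof.
rewrite -(@ler_pXn2r _ 2) ?nnegrE ?enorm_ge0 // !sqr_enorm.
by rewrite -{3 4}(hsubmxK a) dot_row_mx lerDr dot_ge0.
Qed.

Lemma enorm_row_mx (x : 'rV[R]_n) (u : 'rV[R]_m) :
  enorm (row_mx x u) <= enorm x + enorm u.
Proof.
rewrite -(@ler_pXn2r _ 2) ?nnegrE ?addr_ge0 ?enorm_ge0 //.
rewrite sqrrD !sqr_enorm dot_row_mx.
have := mulr_ge0 (enorm_ge0 x) (enorm_ge0 u); lra.
Qed.

Lemma row_mxB (x x' : 'rV[R]_n) (u u' : 'rV[R]_m) :
  row_mx x u - row_mx x' u' = row_mx (x - x') (u - u').
Proof. by rewrite opp_row_mx add_row_mx. Qed.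

(** For [q = (v, u)] and [g = (x, y)], [swap g q] is [(x, u)] and [swap q g] is [(v, y)]. *)
Definition swap a b : 'rV[R]_(n + m) := row_mx (lsubmx a) (rsubmx b).

Lemma swapK a b : swap (swap a b) (swap b a) = a.
Proof. by rewrite /swap row_mxKl row_mxKr hsubmxK. Qed.

Lemma swapD a b c d : swap a b + swap c d = swap (a + c) (b + d).
Proof. by rewrite /swap add_row_mx !linearD. Qed.

Lemma swapZ (k : R) a b : k *: swap a b = swap (k *: a) (k *: b).
Proof. by rewrite /swap scale_row_mx !linearZ. Qed.

Lemma swapB a b c d : swap a b - swap c d = swap (a - c) (b - d).
Proof. by rewrite -scaleN1r swapZ swapD !scaleN1r. Qed.

Lemma swap_subl a b c d : swap c d - a = swap (c - swap a b) (d - swap b a).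
Proof. by rewrite -swapB swapK. Qed.

Lemma enorm_swap a b : enorm (swap a b) <= enorm a + enorm b.
Proof.
apply: le_trans (enorm_row_mx _ _) _.
by apply: lerD; [exact: enorm_lsubmx|exact: enorm_rsubmx].
Qed.

Lemma dot_swap a b c d :
  dot (swap a b) (swap c d) + dot (swap b a) (swap d c) = dot a c + dot b d.
Proof.
rewrite !dot_row_mx -[in dot a c](hsubmxK a) -[in dot _ c](hsubmxK c).
by rewrite -[in dot b d](hsubmxK b) -[in dot _ d](hsubmxK d) !dot_row_mx; ring.
Qed.

(** The reason why partial inversion preserves monotonicity: it does not change the pairing of the
    two components. *)
Lemma dot_swapC a b : dot (swap a b) (swap b a) = dot a b.
Proof.
rewrite dot_row_mx -[in RHS](hsubmxK a) -[in RHS](hsubmxK b) dot_row_mx.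
by rewrite (dotC (rsubmx b)).
Qed.

End EnormRow.

Section PartialInversion.
Variables (R : realType) (n m : nat).
Local Notation N := (n + m)%N.
Variable S : 'rV[R]_N -> set 'rV[R]_N.
Implicit Types (z w q g a : 'rV[R]_N).

Definition partial_inverse q g := S (swap g q) (swap q g).

Let inv_gt0 (k : nat) : 0 < k.+1%:R^-1 :> R.
Proof. by rewrite invr_gt0. Qed.

Let inv_cvg (e : R) : 0 < e -> exists K, forall k, (K <= k)%N -> k.+1%:R^-1 < e.
Proof.
move=> e0; exists (Num.trunc e^-1) => k Kk; rewrite invf_plt ?posrE //.
by apply: lt_le_trans (truncnS_gt _) _; rewrite ler_nat ltnS.
Qed.

Let cvg_inv (z_ : nat -> 'rV[R]_N) z :
  (forall k, enorm (z_ k - z) <= k.+1%:R^-1 + k.+1%:R^-1) -> z_ @ \oo --> z.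
Proof.
move=> hz; apply/cvg_enormP => e e0.
have [K hK] := inv_cvg (divr_gt0 e0 (ltr0n R 2)); exists K => k /hK hk.
by apply: le_lt_trans (hz k) _; rewrite [e]splitr ltrD.
Qed.

(** Partial inversion permutes the coordinates of the graph, and the directions of criterion (A)
    become [dq = 0], [dg = a]. Sequences are recovered by choice at tolerances [k.+1%:R^-1]. *)
Lemma strict_graphical_derivativeP z w a :
  strict_graphical_derivative S z w (swap a 0) (swap 0 a) <->
  tangent_kernel partial_inverse (swap w z) (swap z w) a.
Proof.
split=> [[t_ [z_ [dz_ [w_ [dw_ [[t0 ht] [hz hw] [hdz hdw] h1 h2]]]]]] e e0|h].
  have e20 : 0 < e / 2 by rewrite divr_gt0.
  have [K1 hK1] := (cvg_enormP _ _).1 hz _ e20.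
  have [K2 hK2] := (cvg_enormP _ _).1 hw _ e20.
  have [K3 hK3] := (cvg_enormP _ _).1 hdz _ e20.
  have [K4 hK4] := (cvg_enormP _ _).1 hdw _ e20.
  have [K5 _ hK5] := cvgr_dist_lt _ _ ht _ e0.
  pose k := maxn K1 (maxn K2 (maxn K3 (maxn K4 K5))).
  have k1 : enorm (z_ k - z) < e / 2 by apply: hK1; rewrite !leq_max leqnn ?orbT.
  have k2 : enorm (w_ k - w) < e / 2 by apply: hK2; rewrite !leq_max leqnn ?orbT.
  have k3 : enorm (dz_ k - swap a 0) < e / 2 by apply: hK3; rewrite !leq_max leqnn ?orbT.
  have k4 : enorm (dw_ k - swap 0 a) < e / 2 by apply: hK4; rewrite !leq_max leqnn ?orbT.
  have k5 : `|0 - t_ k| < e by apply: hK5; rewrite /= !leq_max leqnn ?orbT.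
  exists (t_ k), (swap (w_ k) (z_ k)), (swap (z_ k) (w_ k)),
    (swap (dw_ k) (dz_ k)), (swap (dz_ k) (dw_ k)); split.
  - by rewrite t0; move: k5; rewrite sub0r normrN gtr0_norm.
  - by rewrite !swapB; split; apply: le_lt_trans (enorm_swap _ _) _; lra.
  - have -> : swap (dw_ k) (dz_ k) = swap (dw_ k - swap 0 a) (dz_ k - swap a 0).
      by rewrite -swapB swapK subr0.
    have -> : swap (dz_ k) (dw_ k) - a = swap (dz_ k - swap a 0) (dw_ k - swap 0 a).
      by rewrite -swapB swapK.
    by split; apply: le_lt_trans (enorm_swap _ _) _; lra.
  - by rewrite /partial_inverse !swapK.
  - by rewrite /partial_inverse !swapZ !swapD !swapK.
pose good k (p : R * ((('rV[R]_N * 'rV[R]_N) * ('rV[R]_N * 'rV[R]_N))%type)) :=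
  let: e := k.+1%:R^-1 in let: (t, ((q, g), (dq, dg))) := p in
  [/\ 0 < t < e, enorm (q - swap w z) < e /\ enorm (g - swap z w) < e,
      enorm dq < e /\ enorm (dg - a) < e, partial_inverse q g
    & partial_inverse (q + t *: dq) (g + t *: dg)].
have /choice[p hp] : forall k, exists p, good k p.
  move=> k; have [t [q [g [dq [dg hk]]]]] := h _ (inv_gt0 k).
  by exists (t, ((q, g), (dq, dg))).
exists (fun k => (p k).1), (fun k => swap (p k).2.1.2 (p k).2.1.1),
  (fun k => swap (p k).2.2.2 (p k).2.2.1),
  (fun k => swap (p k).2.1.1 (p k).2.1.2),
  (fun k => swap (p k).2.2.1 (p k).2.2.2).
split.
- split=> [k|].
    by have := hp k; case: (p k) => t [[q g] [dq dg]] /= [/andP[]].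
  apply/cvgrPdist_lt => e e0; have [K hK] := inv_cvg e0; exists K => // k /= /hK.
  have := hp k; case: (p k) => t [[q g] [dq dg]] /= [/andP[t0 te] _ _ _ _].
  by rewrite sub0r normrN gtr0_norm //; exact: lt_trans.
- by split; apply: cvg_inv => k; have := hp k;
    case: (p k) => t [[q g] [dq dg]] /= [_ [k1 k2] _ _ _];
    rewrite ?(swap_subl z w) ?(swap_subl w z);
    apply: le_trans (enorm_swap _ _) _; rewrite lerD // ltW.
- by split; apply: cvg_inv => k; have := hp k;
    case: (p k) => t [[q g] [dq dg]] /= [_ _ [k1 k2] _ _];
    rewrite swapB subr0; apply: le_trans (enorm_swap _ _) _; rewrite lerD // ltW.
- by move=> k; have := hp k; case: (p k) => t [[q g] [dq dg]] /= [].
move=> k; have := hp k; case: (p k) => t [[q g] [dq dg]] /= [_ _ _ _].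
by rewrite /partial_inverse !swapZ !swapD.
Qed.

Lemma normal_pair_partial_inverse z w (al be : 'rV[R]_N) :
  normal_pair partial_inverse (swap w z) (swap z w) (swap be al) (swap al be) <->
  regular_normal_cone (gph S) (row_mx z w) (row_mx al be).
Proof.
have dotE' z' w' :
  dot (swap be al) (swap w' z' - swap w z) + dot (swap al be) (swap z' w' - swap z w)
  = dot (row_mx al be) (row_mx z' w' - row_mx z w).
  by rewrite !swapB dot_swap row_mxB dot_row_mx addrC.
rewrite /normal_pair /partial_inverse !swapK /regular_normal_cone /gph /=.
rewrite row_mxKl row_mxKr.
split=> -[hS h]; split=> // e e0.
  (* Each swapped displacement is at most twice the norm of the pair, so their sum is at most 4
     times it. *)
  have [d d0 hd] := h _ (divr_gt0 e0 (ltr0n R 4)).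
  apply/nbhs_enormP; exists (d / 2) => [|p']; first by rewrite divr_gt0.
  rewrite -[p']hsubmxK; move: (lsubmx p') (rsubmx p') => z' w'.
  rewrite row_mxKl row_mxKr => hp' hS'.
  have nl : enorm (z' - z) <= enorm (row_mx z' w' - row_mx z w).
    rewrite row_mxB; apply: le_trans (enorm_lsubmx _).
    by rewrite row_mxKl.
  have nr : enorm (w' - w) <= enorm (row_mx z' w' - row_mx z w).
    rewrite row_mxB; apply: le_trans (enorm_rsubmx _).
    by rewrite row_mxKr.
  have := hd (swap w' z') (swap z' w'); rewrite !swapK => /(_ hS').
  rewrite dotE' !swapB.
  have h1 := enorm_swap (w' - w) (z' - z); have h2 := enorm_swap (z' - z) (w' - w).
  move=> /(_ _ _)/wrap[]; [lra|lra|move/le_trans; apply].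
  by rewrite -mulrA ler_pM2l //; lra.
have /nbhs_enormP[d d0 hd] := h _ (divr_gt0 e0 (ltr0n R 2)).
exists (d / 4) => [|q' g' hS' hq hg]; first by rewrite divr_gt0.
rewrite -[q'](swapK q' g') -[X in dot (swap al be) (X - _)](swapK g' q') dotE'.
have n1 := enorm_swap (g' - swap z w) (q' - swap w z).
have n2 := enorm_swap (q' - swap w z) (g' - swap z w).
have n3 : enorm (row_mx (swap g' q') (swap q' g') - row_mx z w) <=
    2 * (enorm (q' - swap w z) + enorm (g' - swap z w)).
  rewrite row_mxB; apply: le_trans (enorm_row_mx _ _) _.
  by rewrite (swap_subl z w) (swap_subl w z); lra.
have := hd (row_mx (swap g' q') (swap q' g')); rewrite row_mxKl row_mxKr.
move=> /(_ _ hS')/wrap[]; first lra.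
move/le_trans; apply; rewrite swapK -mulrA ler_pM2l //.
by rewrite -(ler_pM2l (ltr0n R 2)) mulrA mulfV // mul1r.
Qed.

(** The minus sign in the definition of the coderivative cancels the one here, leaving the normal
    [(swap 0 a, swap a 0)], which is [(a, 0)] in the coordinates [(q, g)]. *)
Lemma coderivativeP z w a : S z w ->
  coderivative S z w (- swap a 0) (swap 0 a) <->
  normal_kernel partial_inverse (swap w z) (swap z w) a.
Proof.
move=> Szw; rewrite /coderivative /= opprK.
split=> [[_ [p_ [q_ [hp hq hn]]]] e e0|h].
  have e20 : 0 < e / 2 by rewrite divr_gt0.
  have [K1 hK1] := (cvg_enormP _ _).1 hp _ e20.
  have [K2 hK2] := (cvg_enormP _ _).1 hq _ e20.
  have := hK1 _ (leq_maxl K1 K2); have := hK2 _ (leq_maxr K1 K2).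
  have := hn (maxn K1 K2); move: (p_ _) (q_ _) => p q.
  rewrite -[p]hsubmxK -[q]hsubmxK.
  move: (lsubmx p) (rsubmx p) (lsubmx q) (rsubmx q) => z' w' al be.
  move=> /normal_pair_partial_inverse hnp.
  rewrite !row_mxB => hab hzw.
  have /le_lt_trans/(_ hab) := enorm_lsubmx (row_mx (al - swap 0 a) (be - swap a 0)).
  have /le_lt_trans/(_ hab) := enorm_rsubmx (row_mx (al - swap 0 a) (be - swap a 0)).
  have /le_lt_trans/(_ hzw) := enorm_lsubmx (row_mx (z' - z) (w' - w)).
  have /le_lt_trans/(_ hzw) := enorm_rsubmx (row_mx (z' - z) (w' - w)).
  rewrite !row_mxKl !row_mxKr => k1 k2 k3 k4.
  exists (swap w' z'), (swap z' w'), (swap be al), (swap al be); split=> //.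
    by rewrite !swapB; split; apply: le_lt_trans (enorm_swap _ _) _; lra.
  have -> : swap be al - a = swap (be - swap a 0) (al - swap 0 a).
    by rewrite -swapB swapK.
  have -> : swap al be = swap (al - swap 0 a) (be - swap a 0).
    by rewrite -swapB swapK subr0.
  by split; apply: le_lt_trans (enorm_swap _ _) _; lra.
pose good k (p : (('rV[R]_N * 'rV[R]_N) * ('rV[R]_N * 'rV[R]_N))%type) :=
  let: e := k.+1%:R^-1 in let: ((q, g), (a', b)) := p in
  [/\ enorm (q - swap w z) < e /\ enorm (g - swap z w) < e,
      enorm (a' - a) < e /\ enorm b < e & normal_pair partial_inverse q g a' b].
have /choice[p hp] : forall k, exists p, good k p.
  move=> k; have [q [g [a' [b hk]]]] := h _ (inv_gt0 k).
  by exists ((q, g), (a', b)).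
have cvg_row (f1 f2 : nat -> 'rV[R]_N) (y1 y2 : 'rV[R]_N) : f1 @ \oo --> y1 -> f2 @ \oo --> y2 ->
    (fun k => row_mx (f1 k) (f2 k)) @ \oo --> row_mx y1 y2.
  move=> h1 h2;  apply/cvg_enormP => e e0; have e20 : 0 < e / 2 by rewrite divr_gt0.
  have [K1 hK1] := (cvg_enormP _ _).1 h1 _ e20.
  have [K2 hK2] := (cvg_enormP _ _).1 h2 _ e20.
  exists (maxn K1 K2) => k; rewrite geq_max => /andP[/hK1 k1 /hK2 k2].
  by rewrite row_mxB; apply: le_lt_trans (enorm_row_mx _ _) _; lra.
split; first by rewrite /gph /= row_mxKl row_mxKr.
  exists (fun k => row_mx (swap (p k).1.2 (p k).1.1) (swap (p k).1.1 (p k).1.2)),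
    (fun k => row_mx (swap (p k).2.2 (p k).2.1) (swap (p k).2.1 (p k).2.2)).
  split.
  - by apply: cvg_row; apply: cvg_inv => k; have := hp k;
    case: (p k) => [[q g] [a' b]] /= [[k1 k2] _ _];
    rewrite ?(swap_subl z w) ?(swap_subl w z);
    apply: le_trans (enorm_swap _ _) _; rewrite lerD // ltW.
  - by apply: cvg_row; apply: cvg_inv => k; have := hp k;
    case: (p k) => [[q g] [a' b]] /= [_ [k1 k2] _];
    rewrite swapB subr0; apply: le_trans (enorm_swap _ _) _; rewrite lerD // ltW.
  - move=> k; have := hp k; case: (p k) => [[q g] [a' b]] /= [_ _ hn].
    by apply/normal_pair_partial_inverse; rewrite !swapK.
Qed.

End PartialInversion.

(** * Full stability under variational convexity *)

Section Augmented.
Variables (R : realType) (n m : nat).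
Local Notation N := (n + m)%N.
Implicit Types (f : 'rV[R]_N -> \bar R) (z w : 'rV[R]_N).

Lemma augmentedK f (r : R) : augmented (augmented f r) (- r) = f.
Proof.
apply/funext => z; rewrite /augmented -addeA -EFinD.
by rewrite mulNr mulNr subrr adde0.
Qed.

Lemma augmented_regular_subgradient f (r : R) z w : regular_subgradient f z w ->
  regular_subgradient (augmented f r) z (w + row_mx 0 (r *: rsubmx z)).
Proof.
move=> [fz h]; split=> [|e e0]; first by rewrite fin_numD fz.
have /nbhs_enormP[d d0 hd] := h _ (divr_gt0 e0 (ltr0n R 2)).
have r0 : 0 < `|r| + 1 by rewrite ltr_wpDl.
apply/nbhs_enormP; exists (Num.min d (e / (`|r| + 1))) => [|z'].
  by rewrite lt_min d0 divr_gt0.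
rewrite lt_min => /andP[/hd {}hd]; rewrite ltr_pdivlMr // => hz.
move: hd; rewrite /augmented -(fineK fz).
case: (f z') => [b||] //; last by move=> _; rewrite addye // leey.
rewrite -!EFinD !lee_fin.
set v := z' - z in hz *.
have -> : rsubmx z' = rsubmx z + rsubmx v by rewrite -linearD /v addrC subrK.
rewrite dotDl -[X in dot (row_mx _ _) X](hsubmxK v) dot_row_mx dot0l add0r.
have := enorm_rsubmx v; have := enorm_ge0 v; have := enorm_ge0 (rsubmx v).
move: (rsubmx z) (rsubmx v) => u du n1 n2 n3.
have -> : enorm (u + du) ^+ 2 = enorm u ^+ 2 + 2 * dot u du + enorm du ^+ 2.
  by rewrite !sqr_enorm !dotE (dotC du u); ring.
rewrite dotZl.
have h1 : - (`|r| * enorm v ^+ 2) <= r * enorm du ^+ 2.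
  have h2 : enorm du ^+ 2 <= enorm v ^+ 2 by rewrite ler_pXn2r ?nnegrE.
  have := ler_wpM2l (normr_ge0 r) h2.
  have := ler_wpM2r (sqr_ge0 (enorm du)) (ler_norm (- r)); rewrite normrN; lra.
have h2 : `|r| * enorm v ^+ 2 <= e * enorm v.
  by rewrite expr2 mulrA ler_wpM2r //; have := normr_ge0 r; nra.
lra.
Qed.

Lemma augmented_subgradient f (r : R) z w : subgradient f z w ->
  subgradient (augmented f r) z (w + row_mx 0 (r *: rsubmx z)).
Proof.
move=> [fz [z_ [w_ [hz hf hw hr]]]]; split; first by rewrite fin_numD fz.
exists z_, (fun k => w_ k + row_mx 0 (r *: rsubmx (z_ k))).
split=> // [||k]; last exact: augmented_regular_subgradient.
  have h1 : {for z, continuous (fun z : 'rV[R]_N => enorm (rsubmx z))}.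
    apply: (@lipschitz_enorm_continuous _ _ _ 1) => x y.
    rewrite mul1r; apply: le_trans (enorm_sub_le _ _) _.
    by rewrite -linearB; exact: enorm_rsubmx.
  have h2 := continuousM (@cst_continuous _ _ (r / 2) z) (continuousM h1 h1).
  have h3 : (fun k => (r / 2 * enorm (rsubmx (z_ k)) ^+ 2)%:E) @ \oo -->
      (r / 2 * enorm (rsubmx z) ^+ 2)%:E.
    apply: cvg_EFin; first exact: nearW.
    exact: (continuous_cvg _ h2 hz).
  by apply: (cvgeD _ hf h3); rewrite fin_num_adde_defl.
apply/cvg_enormP => e e0.
have r0 : 0 < `|r| + 1 by rewrite ltr_wpDl.
have [K1 hK1] := (cvg_enormP _ _).1 hw _ (divr_gt0 e0 (ltr0n R 2)).
have [K2 hK2] := (cvg_enormP _ _).1 hz _ (divr_gt0 (divr_gt0 e0 (ltr0n R 2)) r0).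
exists (maxn K1 K2) => k; rewrite geq_max => /andP[/hK1 k1 /hK2].
rewrite ltr_pdivlMr // => k2.
rewrite opprD addrACA row_mxB subr0 -scalerBr -linearB.
apply: le_lt_trans (enormD _ _) _; rewrite [e]splitr; apply: ltr_leD => //.
apply: le_trans (enorm_row_mx _ _) _; rewrite enorm0 add0r enormZ.
have := enorm_rsubmx (z_ k - z); have := normr_ge0 r; nra.
Qed.

(** The converse is the same inclusion for [- r], since augmenting by [r] and then by [- r] restores
    [f]. *)
Lemma augmented_subgradientE f (r : R) z w :
  subgradient f z w <-> subgradient (augmented f r) z (w + row_mx 0 (r *: rsubmx z)).
Proof.
split; first exact: augmented_subgradient.
move/(@augmented_subgradient _ (- r)); rewrite augmentedK.
by rewrite -addrA add_row_mx addr0 scaleNr subrr row_mx0 addr0.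
Qed.

End Augmented.

(** * Stability through the local convex model *)

Section ConvexModel.
Variables (R : realType) (n m : nat).
Local Notation N := (n + m)%N.
Variables (phi psi : 'rV[R]_N -> \bar R) (xb : 'rV[R]_n) (yb : 'rV[R]_m) (r : R).
Variables (X : set 'rV[R]_n) (U : set 'rV[R]_m) (V : set 'rV[R]_n) (Y : set 'rV[R]_m).
Hypotheses (nX : nbhs xb X) (nU : nbhs (0 : 'rV[R]_m) U)
  (nV : nbhs (0 : 'rV[R]_n) V) (nY : nbhs yb Y).
Hypothesis model : convex_model (augmented phi r) psi X U V Y.
Hypothesis base : subgradient phi (row_mx xb 0) (row_mx 0 yb).
Local Notation gb := (row_mx xb yb).
Local Notation H := (partial_inverse (subgradient phi)).
Local Notation G := (partial_inverse (subgradient psi)).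
Implicit Types (q g a z w : 'rV[R]_N).

(** Augmentation turns the subgradient [(v, y)] at [(x, u)] into [(v, y + r u)]; in partially
    inverted coordinates it adds [(0, r u)] to [g]. *)
Definition shear_mx : 'M[R]_N := block_mx 0 0 0 r%:M.
Local Notation A := shear_mx.

Lemma mul_shear_mx q : q *m A = row_mx 0 (r *: rsubmx q).
Proof.
rewrite -{1}(hsubmxK q) mul_row_block !mulmx0 addr0 add0r.
by rewrite mul_mx_scalar.
Qed.

Lemma partial_inverse_base : H 0 gb.
Proof.
by rewrite /partial_inverse /swap row_mxKl row_mxKr !linear0.
Qed.

Lemma psi_Ny z : psi z != -oo%E.
Proof. by have [[_ [h _] _] _ _ _] := model; exact: h. Qed.

Lemma psi_convex : convex_on setT psi.
Proof. by have [[_ _ h] _ _ _] := model. Qed.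

Lemma G_supports q g : G q g -> supports psi (swap g q) (swap q g).
Proof. exact: subgradient_supports psi_Ny psi_convex. Qed.

Lemma swap_shear q g : swap q g + row_mx 0 (r *: rsubmx (swap g q)) = swap q (g + q *m A).
Proof.
rewrite /swap row_mxKr add_row_mx addr0 mul_shear_mx linearD /=.
by rewrite row_mxKr.
Qed.

Lemma shear_swap q g : swap (g + q *m A) q = swap g q.
Proof. by rewrite /swap mul_shear_mx linearD /= row_mxKl addr0. Qed.

Lemma model_near : exists2 d : R, 0 < d & forall q g,
  enorm q < d -> enorm (g - gb) < d ->
  [/\ X (lsubmx g), U (rsubmx q), H q g <-> G q (g + q *m A)
    & H q g -> augmented phi r (swap g q) = psi (swap g q)].
Proof.
have [dX dX0 hX] := (nbhs_enormP _ _).1 nX; have [dU dU0 hU] := (nbhs_enormP _ _).1 nU.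
have [dV dV0 hV] := (nbhs_enormP _ _).1 nV; have [dY dY0 hY] := (nbhs_enormP _ _).1 nY.
have [s s0 hs] := mulmx_enorm_bound A.
have s1 : 0 < 1 + s by lra.
(* The factor [1 + s] leaves room for the shear, as [Y] has to contain the sheared multiplier. *)
exists (Num.min (Num.min dX dU) (Num.min dV (dY / (1 + s)))) => [|q g].
  by rewrite !lt_min dX0 dU0 dV0 divr_gt0.
rewrite !lt_min => /andP[/andP[_ qU] /andP[qV qY]] /andP[/andP[gX _] /andP[_ gY]].
have Xg : X (lsubmx g).
  apply: hX; apply: le_lt_trans gX; rewrite -[X in _ - X](row_mxKl xb yb) -linearB.
  exact: enorm_lsubmx.
have Uq : U (rsubmx q).
  by apply: hU; rewrite subr0; apply: le_lt_trans qU; exact: enorm_rsubmx.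
have Vq : V (lsubmx q).
  by apply: hV; rewrite subr0; apply: le_lt_trans qV; exact: enorm_lsubmx.
have Yg : Y (rsubmx (g + q *m A)).
  apply: hY; rewrite -[X in _ - X](row_mxKr xb yb) -linearB.
  apply: le_lt_trans (enorm_rsubmx _) _; rewrite addrAC.
  apply: le_lt_trans (enormD _ _) _; have := hs q.
  by move: qY gY; rewrite !ltr_pdivlMr //; have := enorm_ge0 (g - gb); nra.
have [_ _ eqgph eqval] := model.
pose p := row_mx (swap g q) (swap q (g + q *m A)).
have boxp : box (box X U) (box V Y) p.
  by rewrite /box /p /= !(row_mxKl, row_mxKr).
have HE : H q g <-> subgradient (augmented phi r) (swap g q) (swap q (g + q *m A)).
  by rewrite -swap_shear; exact: augmented_subgradientE.
have mem f : (gph (subgradient f) `&` box (box X U) (box V Y)) p <->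
    subgradient f (swap g q) (swap q (g + q *m A)).
  rewrite /gph /= /p row_mxKl row_mxKr; split=> [[]//|h]; split=> //.
split=> //.
  rewrite HE /partial_inverse shear_swap -(mem psi) -eqgph.
  exact: iff_sym (mem _).
by move=> /HE/mem/eqval; rewrite /p row_mxKl.
Qed.

Lemma model_sheared : sheared A H G 0 gb.
Proof.
have [d d0 hd] := model_near; exists d => // q g; rewrite subr0 => hq hg.
by have [] := hd q g hq hg.
Qed.

Lemma G_monotone : monotone G.
Proof.
move=> q g q' g' /G_supports[f1 h1] /G_supports[f2 h2].
have := h1 (swap g' q'); have := h2 (swap g q).
rewrite -(fineK f1) -(fineK f2) -!EFinD !lee_fin => k2 k1.
rewrite dotC -dot_swapC -!swapB; move: k1 k2.
have -> : swap g q - swap g' q' = - (swap g' q' - swap g q) by rewrite opprB.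
by rewrite dotNr dotDl dotNl; lra.
Qed.

Lemma G_onto : resolvent_onto G.
Proof.
move=> p; have [[lsc _ _] _ _ _] := model.
have [d d0 hd] := model_sheared.
have Gb : G 0 (gb + 0 *m A).
  apply/hd; rewrite ?subrr ?enorm0 //; exact: partial_inverse_base.
have [z hz] := convex_prox psi_Ny psi_convex lsc (G_supports Gb) p.
(* Since [(x, u) + (v, y) = q + g], the proximal point [z = (x, u)] of [psi] at [p] gives
   [q = (v, u)]. *)
exists (swap (p - z) z); rewrite /partial_inverse.
have -> : p - swap (p - z) z = swap z (p - z).
  by rewrite -{1}[p]hsubmxK -/(swap p p) swapB subKr.
by rewrite !swapK; exact: supports_subgradient.
Qed.

(** [psi] minorizes the augmented function and equals it at [(x, u)]. Along fixed [u] the quadratic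
    term cancels and the component [y] drops out of the subgradient inequality. *)
Lemma model_argmin : exists2 d : R, 0 < d & forall q g,
  enorm q < d -> enorm (g - gb) < d -> H q g ->
  [/\ X (lsubmx g), phi (swap g q) \is a fin_num & forall x', X x' ->
    (phi (swap g q) + (dot (lsubmx q) (x' - lsubmx g))%:E
       <= phi (row_mx x' (rsubmx q)))%E].
Proof.
have [d d0 hd] := model_near; exists d => // q g hq hg Hqg.
have [Xg Uq HG /(_ Hqg) hval] := hd q g hq hg.
have fphi : phi (swap g q) \is a fin_num by have [] := Hqg.
split=> // x' Xx'.
have [_ psi_le _ _] := model.
have /HG/G_supports := Hqg; rewrite shear_swap => -[_]; rewrite -hval => hs.
have boxx' : box X U (row_mx x' (rsubmx q)) by rewrite /box /= row_mxKl row_mxKr.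
have := le_trans (hs _) (psi_le _ boxx').
rewrite [X in dot _ X]row_mxB subrr dot_row_mx dot0r addr0 /augmented.
rewrite !row_mxKr -(fineK fphi) -!EFinD.
case: (phi (row_mx x' _)) => [b||] //; last by move=> _; rewrite leey.
by rewrite -!EFinD !lee_fin; lra.
Qed.

Lemma model_Mbar : exists2 d0 : R, 0 < d0 & forall d, 0 < d -> d <= d0 ->
  exists2 rho : R, 0 < rho & forall q g,
    enorm q < rho -> enorm (g - gb) < rho -> H q g ->
    Mbar_delta phi xb yb d (lsubmx q) (rsubmx q) g /\
    m_delta phi xb d (lsubmx q) (rsubmx q) =
      objective phi (lsubmx q) (rsubmx q) (lsubmx g).
Proof.
have [d1 d10 hmin] := model_argmin.
have [dX dX0 hX] := (nbhs_enormP _ _).1 nX.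
(* The closed ball of radius [d] then lies in [X], where the minimality of [x] is known. *)
exists (dX / 2) => [|d d0 ddX]; first by rewrite divr_gt0.
exists (Num.min d1 d) => [|q g]; first by rewrite lt_min d10.
rewrite !lt_min => /andP[q1 _] /andP[g1 g2] Hqg.
have [Xg fphi hm] := hmin q g q1 g1 Hqg.
have gx : enorm (lsubmx g - xb) < d.
  by apply: le_lt_trans g2; rewrite -[X in _ - X](row_mxKl xb yb) -linearB enorm_lsubmx.
have gy : enorm (rsubmx g - yb) < d.
  by apply: le_lt_trans g2; rewrite -[X in _ - X](row_mxKr xb yb) -linearB enorm_rsubmx.
have mE : m_delta phi xb d (lsubmx q) (rsubmx q) =
    objective phi (lsubmx q) (rsubmx q) (lsubmx g).
  apply/eqP; rewrite eq_le; apply/andP; split.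
    by apply: ereal_inf_lbound; exists (lsubmx g) => //=; exact: ltW.
  apply: le_ereal_inf_tmp => _ [x' /= hx' <-].
  have /hm : X x' by apply: hX; apply: le_lt_trans hx' _; lra.
  rewrite /objective -/(swap g q) -(fineK fphi).
  case: (phi (row_mx x' _)) => [b||] //; last by move=> _; rewrite leey.
  by rewrite -!EFinB -EFinD !lee_fin dotDr dotNr; lra.
split=> //; split.
- split; [exact: ltW| |by rewrite mE].
  by rewrite /objective -/(swap g q) -(fineK fphi) -EFinB ltry.
(* Minimality of [x] on [X] for the tilted function says that [v] supports the partial function near
   [x]. *)
- split=> //; apply: regular_subgradient_subgradient.
  apply: (@supports_regular_subgradient _ _ _ _ _ (dX / 2) 0) => //.
    by rewrite divr_gt0.
  move=> x' hx'; rewrite mul0r subr0; apply: hm; apply: hX.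
  by apply: le_lt_trans (enorm_subD (lsubmx g) _ _) _; lra.
- exact: ltW.
Qed.

(** The inequality of [psi] at the first point, read at the second, bounds the difference of the
    values by [(v2 - v1).x2 + y1.(u1 - u2) + r/2 |u1 - u2|^2]. Exchanging the points gives the
    Lipschitz bound. *)
Lemma model_value_le : exists2 d : R, 0 < d & forall q1 g1 q2 g2,
  enorm q1 < d -> enorm (g1 - gb) < d -> enorm q2 < d -> enorm (g2 - gb) < d ->
  H q1 g1 -> H q2 g2 ->
  fine (objective phi (lsubmx q1) (rsubmx q1) (lsubmx g1)) <=
  fine (objective phi (lsubmx q2) (rsubmx q2) (lsubmx g2)) +
  (enorm g1 + enorm g2 + `|r| * enorm (q1 - q2)) * enorm (q1 - q2).
Proof.
have [d d0 hd] := model_near; exists d => // q1 g1 q2 g2 hq1 hg1 hq2 hg2 H1 H2.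
have [_ _ HG1 /(_ H1) val1] := hd _ _ hq1 hg1.
have [_ _ _ /(_ H2) val2] := hd _ _ hq2 hg2.
have [f1 _] := H1; have [f2 _] := H2.
have /HG1/G_supports[_ /(_ (swap g2 q2))] := H1.
rewrite shear_swap -val1 -val2 /augmented /objective -!/(swap _ _).
rewrite -(fineK f1) -(fineK f2) -!EFinB -!EFinD !lee_fin /=.
rewrite swapB /swap !row_mxKr dot_row_mx mul_shear_mx [rsubmx (g1 + _)]linearD /= row_mxKr.
rewrite [lsubmx (g2 - g1)]linearB [rsubmx (q2 - q1)]linearB /=.
set e := enorm (q1 - q2); have e0 : 0 <= e := enorm_ge0 _.
have hv : enorm (lsubmx q2 - lsubmx q1) <= e.
  by rewrite /e enormB -linearB enorm_lsubmx.
have hu : enorm (rsubmx q1 - rsubmx q2) <= e by rewrite -linearB enorm_rsubmx.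
have h1 : dot (lsubmx q2 - lsubmx q1) (lsubmx g2) <= e * enorm g2.
  apply: le_trans (dot_le _ _) _.
  by apply: ler_pM; rewrite ?enorm_ge0 // enorm_lsubmx.
have h2 : dot (rsubmx g1) (rsubmx q1 - rsubmx q2) <= enorm g1 * e.
  apply: le_trans (dot_le _ _) _.
  by apply: ler_pM; rewrite ?enorm_ge0 // enorm_rsubmx.
have h3 : r * enorm (rsubmx q1 - rsubmx q2) ^+ 2 <= `|r| * e ^+ 2.
  apply: le_trans (ler_wpM2r (sqr_ge0 _) (ler_norm r)) _.
  by rewrite ler_wpM2l // ler_pXn2r ?nnegrE ?enorm_ge0.
have h4 : 0 <= `|r| * e ^+ 2 by rewrite mulr_ge0 ?sqr_ge0.
move: h1 h2 h3; clearbody e; rewrite !sqr_enorm.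
move: (lsubmx q1) (rsubmx q1) (lsubmx q2) (rsubmx q2) (lsubmx g1) (rsubmx g1)
  (lsubmx g2) {hv hu} => v1 u1 v2 u2 x1 y1 x2.
by rewrite !dotE (dotC u2 u1); lra.
Qed.

Lemma lipschitz_on_bound (K : normedModType R) (f : 'rV[R]_N -> K) (B : set 'rV[R]_N) (C : R) :
  (forall p p', B p -> B p' -> `|f p - f p'| <= C * enorm (p - p')) ->
  [lipschitz f p | p in B].
Proof.
move=> hC; exists (`|C| * N.+1%:R); split; first exact: num_real.
move=> M CM [p p'] [/= Bp Bp']; apply: le_trans (hC p p' Bp Bp') _.
apply: (@le_trans _ _ (`|C| * enorm (p - p'))).
  by rewrite ler_wpM2r ?enorm_ge0 ?ler_norm.
apply: (@le_trans _ _ (`|C| * (N.+1%:R * `|p - p'|))).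
  by rewrite ler_wpM2l // enorm_le_normr.
by rewrite mulrA ler_wpM2r // ltW.
Qed.

Lemma localization_fully_stable :
  lipschitz_localization H 0 gb -> fully_stable phi 0 0 xb yb.
Proof.
move=> [rho rho0 [L L0 [Hex Hlip]]].
have [d1 d10 hM] := model_Mbar; have [d2 d20 hval] := model_value_le.
rewrite /fully_stable; near=> d.
have d0 : 0 < d by near: d; exact: nbhs_right_gt.
have dd1 : d <= d1 by near: d; exact: nbhs_right_le.
(* Elements of [Mbar_delta] are then within [2 * d < rho] of [gb], where the localization forces
   uniqueness. *)
have drho : d < rho / 2 by near: d; apply: nbhs_right_lt; rewrite divr_gt0.
have [rho1 rho10 {}hM] := hM d d0 dd1.
pose K := Num.min rho (Num.min rho1 d2).
have K0 : 0 < K by rewrite !lt_min rho0 rho10.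
have [Krho Krho1 Kd2] : [/\ K <= rho, K <= rho1 & K <= d2].
  by rewrite !ge_min !lexx !orbT.
clearbody K.
pose e := K / (1 + L).
have e0 : 0 < e by rewrite divr_gt0 //; lra.
have eK : e * (1 + L) = K by rewrite /e mulfVK // gt_eqF //; lra.
clearbody e.
(* A local selection of [H], with default value 0 outside the ball of radius [e]. *)
have /choice[s hs] : forall q, exists g, enorm q < e -> H q g /\ enorm (g - gb) < K.
  move=> q; have [qe|] := ltP (enorm q) e; last by exists 0.
  have [|g Hqg hg] := Hex q; first by rewrite subr0; nra.
  exists g => _; split => //; apply: le_lt_trans hg _; rewrite subr0.
  have : L * enorm q < L * e by rewrite ltr_pM2l.
  lra.
have eK' : e <= K by nra.
have ball0 k : nbhs (0 : 'rV[R]_k) [set v | enorm v < e / 2].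
  by apply/nbhs_enormP; exists (e / 2) => [|v]; rewrite ?divr_gt0 // subr0.
have qe v u : enorm v < e / 2 -> enorm u < e / 2 -> enorm (row_mx v u : 'rV[R]_N) < e.
  by move=> hv hu; apply: le_lt_trans (enorm_row_mx _ _) _; lra.
have box_e p : box [set v : 'rV[R]_n | enorm v < e / 2] [set u : 'rV[R]_m | enorm u < e / 2] p ->
    enorm p < e.
  by move=> [/= h1 h2]; rewrite -(hsubmxK p); exact: qe.
exists [set v | enorm v < e / 2], [set u | enorm u < e / 2]; split=> //.
  exists s => [v u /= hv hu|]; last first.
    apply: (@lipschitz_on_bound _ _ _ L) => p p' /box_e hp /box_e hp'.
    apply: le_trans (normr_le_enorm _) _.
    have [H1 k1] := hs p hp; have [H2 k2] := hs p' hp'.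
    by apply: Hlip => //; rewrite ?subr0; lra.
  have hq := qe v u hv hu; have [Hs ks] := hs _ hq.
  apply/seteqP; split=> [p [[hx _ _] [_ hp] hy]|_ ->] /=.
    have {}hp : H (row_mx v u) p by rewrite /partial_inverse /swap row_mxKl row_mxKr.
    have pgb : enorm (p - gb) < rho.
      rewrite -{1}(hsubmxK p) row_mxB.
      by apply: le_lt_trans (enorm_row_mx _ _) _; lra.
    apply/subr0_eq/enorm_eq0/eqP; rewrite eq_le enorm_ge0 andbT.
    have := Hlip _ _ _ _ hp Hs; rewrite subrr enorm0 mulr0; apply; rewrite ?subr0; lra.
  have [||+ _] := hM (row_mx v u) (s (row_mx v u)) _ _ Hs; [lra|lra|].
  by rewrite row_mxKl row_mxKr.
pose obj q := objective phi (lsubmx q) (rsubmx q) (lsubmx (s q)).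
exists (fun q => fine (obj q)) => [v u /= hv hu|].
  have hq := qe v u hv hu; have [Hs ks] := hs _ hq.
  have [||_] := hM (row_mx v u) (s (row_mx v u)) _ _ Hs; [lra|lra|].
  rewrite /obj row_mxKl row_mxKr => ->; rewrite fineK //.
  have [] := Hs; rewrite /swap row_mxKr /objective => f1 _.
  by rewrite -(fineK f1) -EFinB.
apply: (@lipschitz_on_bound R^o _ _ (2 * (enorm (gb : 'rV[R]_N) + K) + `|r| * (2 * e))).
move=> p p' /box_e hp /box_e hp'.
have [H1 k1] := hs p hp; have [H2 k2] := hs p' hp'.
have side q q' : enorm q < e -> enorm q' < e -> fine (obj q) - fine (obj q') <=
    (2 * (enorm (gb : 'rV[R]_N) + K) + `|r| * (2 * e)) * enorm (q - q').
  move=> hq hq'; have [{}H1 {}k1] := hs q hq; have [{}H2 {}k2] := hs q' hq'.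
  have := hval q (s q) q' (s q'); rewrite -/(obj q) -/(obj q').
  move=> /(_ _ _ _ _ H1 H2)/wrap[]; [lra|lra|lra|lra|].
  rewrite -lerBlDl => h; apply: le_trans h _; rewrite ler_wpM2r ?enorm_ge0 //.
  have := enormD (s q - gb) gb; have := enormD (s q' - gb) gb; rewrite !subrK.
  have : `|r| * enorm (q - q') <= `|r| * (2 * e).
    rewrite ler_wpM2l //; apply: le_trans (enormD _ _) _; rewrite enormN; lra.
  lra.
rewrite ler_norml; apply/andP; split; last exact: side.
by rewrite lerNl opprB enormB; exact: side.
Unshelve. all: by end_near.
Qed.

(** By [model_Mbar], graph points near the base lie in [Mbar_delta], hence are values of its
    Lipschitz selection. *)
Lemma fully_stable_lipschitz : fully_stable phi 0 0 xb yb ->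
  exists2 rho : R, 0 < rho & exists2 L : R, 0 < L &
  forall q1 g1 q2 g2, H q1 g1 -> H q2 g2 ->
     enorm (q1 - 0) < rho -> enorm (g1 - gb) < rho ->
     enorm (q2 - 0) < rho -> enorm (g2 - gb) < rho ->
     enorm (g1 - g2) <= L * enorm (q1 - q2).
Proof.
move=> fs; have [d1 d10 hM] := model_Mbar.
have [d [d0 dd1 hd]] : exists d : R, [/\ 0 < d, d <= d1 &
  exists V U, [/\ nbhs (0 : 'rV[R]_n) V, nbhs (0 : 'rV[R]_m) U,
        exists2 s : 'rV[R]_(n + m) -> 'rV[R]_(n + m),
          forall v u, V v -> U u ->
            Mbar_delta phi xb yb d v u = [set s (row_mx v u)]
          & [lipschitz s p | p in box V U]
      & exists2 mu : 'rV[R]_(n + m) -> R^o,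
          forall v u, V v -> U u ->
            m_delta phi xb d v u = (mu (row_mx v u))%:E
          & [lipschitz mu p | p in box V U]]].
  near (0 : R)^'+ => d; exists d; split.
  - by near: d; exact: nbhs_right_gt.
  - by near: d; exact: nbhs_right_le.
  - by near: d; exact: fs.
have [rho1 rho10 {}hM] := hM d d0 dd1.
have [V0 [U0 [nV0 nU0 [s hs [M [_ hlip]]] _]]] := hd.
have [dV dV0 hV] := (nbhs_enormP _ _).1 nV0; have [dU dU0 hU] := (nbhs_enormP _ _).1 nU0.
(* The Lipschitz bound holds for all constants above [M], whose sign is unknown; [M'] is a positive
   one. *)
pose M' := Num.max M 0 + 1.
have M'0 : 0 < M' by rewrite ltr_wpDl // le_max lexx orbT.
have MM' : M < M' by rewrite ltr_pwDr // le_max lexx.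
exists (Num.min rho1 (Num.min dV dU)); first by rewrite !lt_min rho10 dV0.
exists (N.+1%:R * M'); first by rewrite mulr_gt0.
move=> q1 g1 q2 g2 H1 H2; rewrite !subr0 !lt_min.
move=> /and3P[q1M q1V q1U] /and3P[g1M _ _] /and3P[q2M q2V q2U] /and3P[g2M _ _].
have inbox q : enorm q < dV -> enorm q < dU -> box V0 U0 q.
  move=> h1 h2; split; [apply: hV|apply: hU]; rewrite subr0.
    by apply: le_lt_trans h1; exact: enorm_lsubmx.
  by apply: le_lt_trans h2; exact: enorm_rsubmx.
have val q g : enorm q < rho1 -> enorm (g - gb) < rho1 -> box V0 U0 q -> H q g -> g = s q.
  move=> h1 h2 [h3 h4] Hqg; have [+ _] := hM q g h1 h2 Hqg.
  by rewrite hs // hsubmxK.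
have B1 := inbox q1 q1V q1U; have B2 := inbox q2 q2V q2U.
rewrite (val q1 g1) // (val q2 g2) //.
apply: le_trans (enorm_le_normr _) _; rewrite -mulrA ler_pM2l //.
have := hlip M' MM' (q1, q2) (conj B1 B2) => /= h; apply: le_trans h _.
by rewrite ler_pM2l // normr_le_enorm.
Unshelve. all: by end_near.
Qed.

(** The converse goes through the normal criterion: kernel normals are tangents, so they vanish and
    the localization exists. *)
Lemma fully_stable_tangent_kernel :
  fully_stable phi 0 0 xb yb <-> forall a, tangent_kernel H 0 gb a -> a = 0.
Proof.
split=> [/fully_stable_lipschitz[rho rho0 [L L0 hL]] a|ht].
  exact: tangent_kernel_lipschitz rho0 L0 hL.
apply: localization_fully_stable.
apply: (lipschitz_localization_sheared_resolvent G_monotone G_onto model_sheared).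
  exact: partial_inverse_base.
by move=> a /(normal_kernel_tangent_sheared G_monotone G_onto model_sheared); exact: ht.
Qed.

Lemma fully_stable_normal_kernel :
  fully_stable phi 0 0 xb yb <-> forall a, normal_kernel H 0 gb a -> a = 0.
Proof.
split=> [/fully_stable_tangent_kernel ht a|hn].
  by move=> /(normal_kernel_tangent_sheared G_monotone G_onto model_sheared); exact: ht.
apply: localization_fully_stable.
apply: (lipschitz_localization_sheared_resolvent G_monotone G_onto model_sheared) hn.
exact: partial_inverse_base.
Qed.

Lemma normal_kernel_tangent_model a :
  normal_kernel H 0 gb a -> tangent_kernel H 0 gb a.
Proof. exact: normal_kernel_tangent_sheared G_monotone G_onto model_sheared. Qed.

(** * Strongly convex models *)

Section StrongModel.
Variable s : R.
Hypotheses (s0 : 0 < s) (strong : convex_on (box X U)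
  (fun z => psi z - (s / 2 * enorm (z - row_mx xb 0) ^+ 2)%:E)%E).

(* Strong convexity is only used at midpoints, hence [s / 4] instead of [s / 2]. *)
Lemma strong_supports z w z' : box X U z -> box X U z' -> supports psi z w ->
  psi z' \is a fin_num ->
  fine (psi z) + dot w (z' - z) + s / 4 * enorm (z' - z) ^+ 2 <= fine (psi z').
Proof.
move=> Bz Bz' [fz hw] fz'.
have h12 : 0 <= (1 / 2 : R) <= 1 by lra.
have := strong Bz' Bz h12.
have mid : (1 / 2) *: z' + (1 - 1 / 2) *: z = z + (1 / 2) *: (z' - z).
  by apply/rowP => i; rewrite !mxE; lra.
have := hw (z + (1 / 2) *: (z' - z)); rewrite [z + _ - z]addrC addKr dotZr mid.
case: (psi (z + _)) => [c||] //; rewrite -(fineK fz) -(fineK fz') //.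
rewrite -!EFinB -!EFinM -!EFinD !lee_fin /=.
have -> : z + (1 / 2) *: (z' - z) - row_mx xb 0
    = (1 / 2) *: (z' - row_mx xb 0) + (1 / 2) *: (z - row_mx xb 0).
  by apply/rowP => i; rewrite !mxE; lra.
have -> : enorm (z' - z) ^+ 2 = enorm ((z' - row_mx xb 0) - (z - row_mx xb 0)) ^+ 2.
  by congr (enorm _ ^+ 2); apply/rowP => i; rewrite !mxE; ring.
move: (z' - row_mx xb 0) (z - row_mx xb 0) (dot w _) => d' d e.
rewrite !sqr_enorm !dotE (dotC d' d); lra.
Qed.

(** Adding two strong subgradient inequalities gives [s / 4 + s / 4]; of the increment of [(x, u)]
    only the part belonging to [g] is kept. *)
Lemma G_strongly_monotone q g q' g' : box X U (swap g q) -> box X U (swap g' q') ->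
  G q g -> G q' g' ->
  s / 2 * enorm (lsubmx (g' - g)) ^+ 2 <= dot (q' - q) (g' - g).
Proof.
move=> B1 B2 /G_supports h1 /G_supports h2.
have := strong_supports B1 B2 h1 h2.1; have := strong_supports B2 B1 h2 h1.1.
rewrite (enormB (swap g q)) -(dot_swapC (q' - q)) -!swapB.
have -> : swap g q - swap g' q' = - (swap g' q' - swap g q) by rewrite opprB.
rewrite dotNr dotDl dotNl => k1 k2.
have : enorm (lsubmx (g' - g)) ^+ 2 <= enorm (swap g' q' - swap g q) ^+ 2.
  rewrite ler_pXn2r ?nnegrE ?enorm_ge0 // swapB.
  by apply: le_trans (enorm_lsubmx _); rewrite row_mxKl.
move/(ler_wpM2l (ltW s0)); lra.
Qed.

(** After division by [t^2], strong monotonicity bounds [s / 2 |lsubmx dg|^2] by [dot dq dg], which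
    tends to 0 while [dg] tends to [a]. *)
Lemma strong_tangent_kernel a : tangent_kernel H 0 gb a -> lsubmx a = 0.
Proof.
move=> /(tangent_kernel_sheared model_sheared); rewrite mul0mx addr0 => ha.
apply: contrapT => /eqP /enorm_gt0; set c := enorm _ => c0.
have [d d0 hd] := model_near.
pose M := enorm a + 2.
have M2 : 2 <= M by rewrite lerDr enorm_ge0.
(* The bound [c / 2] keeps [|lsubmx dg| >= c / 2], so [dot dq dg] is at least [s c^2 / 8 >= 2 M e],
   whereas it is at most [e (M - 1)]. *)
pose e := Num.min (Num.min 1 (c / 2)) (Num.min (d / (2 * M)) (s * c ^+ 2 / (16 * M))).
have e0 : 0 < e.
  by rewrite !lt_min ltr01 !divr_gt0 ?mulr_gt0 ?exprn_gt0 //=; lra.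
have e1 : e <= 1 by rewrite !ge_min lexx.
have e2 : e <= c / 2 by rewrite !ge_min lexx !orbT.
have e3 : e * (2 * M) <= d.
  by rewrite -ler_pdivlMr; [rewrite !ge_min lexx !orbT|lra].
have e4 : e * (16 * M) <= s * c ^+ 2.
  by rewrite -ler_pdivlMr; [rewrite !ge_min lexx !orbT|lra].
clearbody e.
have [t [q [g [dq [dg [/andP[t0 te] [hq hg] [hdq hdg] h1 h2]]]]]] := ha e e0.
rewrite subr0 in hq.
have t0' := ltW t0; have Mpos := enorm_ge0 dq; have Mpos' := enorm_ge0 dg.
have dgM : enorm dg <= M - 1.
  have := enormD (dg - a) a; rewrite subrK /M; lra.
have B q' g' : enorm q' < d -> enorm (g' - gb) < d -> box X U (swap g' q').
  by move=> k1 k2; have [k3 k4 _ _] := hd q' g' k1 k2; rewrite /box /= row_mxKl row_mxKr.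
have eM : 2 * e <= e * M by rewrite mulrC ler_pM2l.
have B1 : box X U (swap g q) by apply: B; lra.
have B2 : box X U (swap (g + t *: dg) (q + t *: dq)).
  apply: B.
    by apply: le_lt_trans (enormD _ _) _; rewrite enormZ_ge0 //; nra.
  rewrite addrAC; apply: le_lt_trans (enormD _ _) _; rewrite enormZ_ge0 //.
  have : t * enorm dg <= e * (M - 1) by apply: ler_pM => //; lra.
  lra.
have := G_strongly_monotone B1 B2 h1 h2.
rewrite [q + _ - q]addrC [g + _ - g]addrC !addKr dotZl dotZr linearZ /= enormZ_ge0 //.
rewrite exprMn mulrCA expr2 -mulrA !ler_pM2l // => hs.
have hc : c / 2 <= enorm (lsubmx dg).
  have := enormD (lsubmx (a - dg)) (lsubmx dg); rewrite -linearD subrK -/c.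
  have := enorm_lsubmx (a - dg); rewrite enormB; lra.
have hc2 : c ^+ 2 / 4 <= enorm (lsubmx dg) ^+ 2.
  have : (c / 2) ^+ 2 <= enorm (lsubmx dg) ^+ 2.
    by rewrite ler_pXn2r ?nnegrE ?enorm_ge0 ?divr_ge0 // ltW.
  by rewrite expr_div_n; lra.
have := ler_wpM2l (ltW s0) hc2.
have : dot dq dg <= e * (M - 1).
  by apply: le_trans (dot_le _ _) _; apply: ler_pM => //; exact: ltW.
have : 0 < e * M by rewrite mulr_gt0 //; lra.
lra.
Qed.

End StrongModel.

End ConvexModel.

(** * The two criteria in partially inverted coordinates *)

Section Translation.
Variables (R : realType) (n m : nat) (S : 'rV[R]_(n + m) -> set 'rV[R]_(n + m)).
Variables (xb x' : 'rV[R]_n) (yb y' : 'rV[R]_m).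

Lemma strict_graphical_derivative_kernel :
  strict_graphical_derivative S (row_mx xb 0) (row_mx 0 yb)
    (row_mx x' 0) (row_mx 0 y') <->
  tangent_kernel (partial_inverse S) 0 (row_mx xb yb) (row_mx x' y').
Proof.
have := strict_graphical_derivativeP S (row_mx xb 0) (row_mx 0 yb) (row_mx x' y').
by rewrite /swap !(row_mxKl, row_mxKr, linear0) row_mx0.
Qed.

Lemma coderivative_kernel : S (row_mx xb 0) (row_mx 0 yb) ->
  coderivative S (row_mx xb 0) (row_mx 0 yb) (row_mx x' 0) (row_mx 0 y') <->
  normal_kernel (partial_inverse S) 0 (row_mx xb yb) (row_mx (- x') y').
Proof.
move=> hS; have := @coderivativeP _ _ _ S (row_mx xb 0) (row_mx 0 yb) (row_mx (- x') y') hS.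
rewrite /swap !(row_mxKl, row_mxKr, linear0) row_mx0.
by rewrite opp_row_mx opprK oppr0.
Qed.

End Translation.

Theorem theorem3p5 (R : realType) (n m : nat)
    (phi : 'rV[R]_(n + m) -> \bar R)
    (phi_closed : lower_semicontinuous phi)
    (phi_proper : proper_function phi)
    (xb : 'rV[R]_n) (yb : 'rV[R]_m)
    (xb_opt : locally_optimal phi 0 0 xb)
    (bcq : basic_cq phi xb 0)
    (prox : forall yh, multipliers phi xb 0 0 yh ->
       continuously_prox_regular phi xb 0 0 yh)
    (yb_mult : multipliers phi xb 0 0 yb) :
  (variational_sufficiency phi xb 0 0 yb ->
     (fully_stable phi 0 0 xb yb <->
        (forall (x' : 'rV[R]_n) (y' : 'rV[R]_m),
           strict_graphical_derivative (subgradient phi)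
             (row_mx xb 0) (row_mx 0 yb) (row_mx x' 0) (row_mx 0 y') ->
           x' = 0 /\ y' = 0)) /\
     (fully_stable phi 0 0 xb yb <->
        (forall (x' : 'rV[R]_n) (y' : 'rV[R]_m),
           coderivative (subgradient phi)
             (row_mx xb 0) (row_mx 0 yb) (row_mx x' 0) (row_mx 0 y') ->
           x' = 0 /\ y' = 0))) /\
  (strong_variational_sufficiency phi xb 0 0 yb ->
     (fully_stable phi 0 0 xb yb <->
        (forall y' : 'rV[R]_m,
           strict_graphical_derivative (subgradient phi)
             (row_mx xb 0) (row_mx 0 yb) 0 (row_mx 0 y') ->
           y' = 0)) /\
     (fully_stable phi 0 0 xb yb <->
        (forall y' : 'rV[R]_m,
           coderivative (subgradient phi)
             (row_mx xb 0) (row_mx 0 yb) 0 (row_mx 0 y') ->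
           y' = 0))).
Proof.
have [_ base] := yb_mult.
have row0 (a : 'rV[R]_n) (b : 'rV[R]_m) : row_mx a b = 0 -> a = 0 /\ b = 0.
  by rewrite -row_mx0 => /eq_row_mx.
have cor := coderivative_kernel _ _ base.
split=> [[r _ [_ [X [U [V [Y [psi [nX nU nV nY model]]]]]]]]|].
  have FT := fully_stable_tangent_kernel nX nU nV nY model base.
  have FN := fully_stable_normal_kernel nX nU nV nY model base.
  split.
    rewrite FT; split=> [h x' y' /strict_graphical_derivative_kernel/h/row0 //|h a].
    rewrite -(hsubmxK a) => /strict_graphical_derivative_kernel/h[-> ->].
    exact: row_mx0.
  rewrite FN; split=> [h x' y' /cor/h/row0[/eqP]|h a].
    by rewrite oppr_eq0 => /eqP -> ->.
  rewrite -(hsubmxK a) -[lsubmx a]opprK => /cor/h[-> ->].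
  by rewrite oppr0 row_mx0.
move=> [r _ [_ [X [U [V [Y [psi [[nX nU nV nY] model _ [s s0 strong]]]]]]]]].
have FT := fully_stable_tangent_kernel nX nU nV nY model base.
have FN := fully_stable_normal_kernel nX nU nV nY model base.
have ST := strong_tangent_kernel nX nU nV nY model s0 strong.
have NT := normal_kernel_tangent_model nX nU nV nY model base.
split.
  rewrite FT; split=> [h y'|h a ha].
    by rewrite -row_mx0 => /strict_graphical_derivative_kernel/h/row0[].
  have a0 := ST a ha; move: ha; rewrite -(hsubmxK a) a0.
  by move=> /strict_graphical_derivative_kernel; rewrite row_mx0 => /h ->; exact: row_mx0.
rewrite FN; split=> [h y'|h a ha].
  by rewrite -row_mx0 => /cor/h/row0[].
(* A kernel normal is a tangent, so strong monotonicity annihilates its [x]-component. *)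
have a0 := ST a (NT a ha); move: ha; rewrite -(hsubmxK a) -[lsubmx a]opprK a0 oppr0.
by move=> /cor; rewrite row_mx0 => /h ->; rewrite oppr0 row_mx0.
Qed.
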